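(* Let $\mathcal{C}$ be a symmetric monoidal category. There is an equivalence between the category $\mathsf{SplitExt}(\mathsf{AssHopf}_{\mathcal{C}})$ of split extensions of associative Hopf algebras in $\mathcal{C}$ and the category $\mathsf{Act}(\mathsf{AssHopf}_{\mathcal{C}})$ of actions of associative Hopf algebras in $\mathcal{C}$.
   Context: $(\mathcal{C},\otimes,I,\sigma)$ is a symmetric monoidal category (associativity and unit isomorphisms are suppressed); $f\cdot g$ denotes composition ($g$ first) and $1_X$ the identity of $X$. An associative bialgebra is $(B,m,u_B,\Delta,\epsilon_B)$ with $(B,m,u_B)$ an associative unital algebra, $(B,\Delta,\epsilon_B)$ a coassociative counital coalgebra, and $\Delta\cdot m=(m\otimes m)\cdot(1_B\otimes\sigma_{B,B}\otimes 1_B)\cdot(\Delta\otimes\Delta)$, $\Delta\cdot u_B=u_B\otimes u_B$, $\epsilon_B\cdot m=\epsilon_B\otimes\epsilon_B$, $\epsilon_B\cdot u_B=1_I$. An associative Hopf algebra is an associative bialgebra $A$ with an antipode $S\colon A\to A$, i.e. $m\cdot(S\otimes 1_A)\cdot\Delta=u_A\cdot\epsilon_A=m\cdot(1_A\otimes S)\cdot\Delta$ (it is unique and automatically an antihomomorphism of algebras and coalgebras). Morphisms of associative Hopf algebras are bialgebra morphisms (preserving $m,u,\Delta,\epsilon$); they automatically preserve antipodes. Objects of $\mathsf{Act}(\mathsf{AssHopf}_{\mathcal{C}})$: morphisms $\triangleright\colon B\otimes X\to X$ in $\mathcal{C}$, with $B,X$ associative Hopf algebras, such that $\triangleright\cdot(u_B\otimes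 1_X)=1_X$; $\triangleright\cdot(1_B\otimes u_X)=u_X\cdot\epsilon_B$; $(1_B\otimes\triangleright)\cdot(\Delta\otimes 1_X)=(1_B\otimes\triangleright)\cdot(\sigma_{B,B}\otimes 1_X)\cdot(\Delta\otimes 1_X)$; $\epsilon_X\cdot\triangleright=\epsilon_B\otimes\epsilon_X$; $\Delta\cdot\triangleright=(\triangleright\otimes\triangleright)\cdot(1_B\otimes\sigma_{B,X}\otimes 1_X)\cdot(\Delta\otimes\Delta)$; $\triangleright\cdot(1_B\otimes\triangleright)=\triangleright\cdot(m\otimes 1_X)$; $\triangleright\cdot(1_B\otimes m)=m\cdot(\triangleright\otimes\triangleright)\cdot(1_B\otimes\sigma_{B,X}\otimes 1_X)\cdot(\Delta\otimes 1_X\otimes 1_X)$. Morphisms from $\triangleright$ to $\triangleright'\colon B'\otimes X'\to X'$: pairs of Hopf algebra morphisms $g\colon B\to B'$, $v\colon X\to X'$ with $v\cdot\triangleright=\triangleright'\cdot(g\otimes v)$. Objects of $\mathsf{SplitExt}(\mathsf{AssHopf}_{\mathcal{C}})$: associative Hopf algebras $X,A,B$, Hopf algebra morphisms $\kappa\colon X\to A$, $\alpha\colon A\to B$, $e\colon B\to A$ and a morphism $\lambda\colon A\to X$ in $\mathcal{C}$ such that (1') $\lambda\cdot\kappa=1_X$, $\alpha\cdot e=1_B$; (2') $\lambda\cdot e=u_X\cdot\epsilon_B$, $\alpha\cdot\kappa=u_B\cdot\epsilon_X$; (3') $m\cdot((\kappa\cdot\lambda)\otimes(e\cdot\alpha))\cdot\Delta=1_A$;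 (4') $\lambda\cdot m\cdot(\kappa\otimes e)=1_X\otimes\epsilon_B$; (5') $(1_B\otimes\lambda)\cdot(1_B\otimes m)\cdot(1_B\otimes e\otimes\kappa)\cdot(\Delta\otimes 1_X)=(1_B\otimes\lambda)\cdot(1_B\otimes m)\cdot(1_B\otimes e\otimes\kappa)\cdot(\sigma_{B,B}\otimes 1_X)\cdot(\Delta\otimes 1_X)$; (6') $\lambda$ is a morphism of coalgebras (preserving $\Delta,\epsilon$) and preserves the unit. Morphisms from $(X,A,B,\kappa,\alpha,e,\lambda)$ to $(X',A',B',\kappa',\alpha',e',\lambda')$: triples $(g,v,p)$ of Hopf algebra morphisms $g\colon B\to B'$, $v\colon X\to X'$, $p\colon A\to A'$ with $p\cdot\kappa=\kappa'\cdot v$, $p\cdot e=e'\cdot g$, $\alpha'\cdot p=g\cdot\alpha$, $\lambda'\cdot p=v\cdot\lambda$. *)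

(* Defs.v *)
From Stdlib Require Import ProofIrrelevance.

Set Implicit Arguments.
Unset Strict Implicit.
Unset Printing Implicit Defensive.
#[local] Obligation Tactic := intros; simpl.

Declare Scope cat_scope.
Delimit Scope cat_scope with cat.
Local Open Scope cat_scope.

Reserved Notation "A ~> B" (at level 90, no associativity).
Reserved Notation "f ∘ g" (at level 40, left associativity).
Reserved Notation "A ⊗ B" (at level 38, left associativity).
Reserved Notation "f ⊠ g" (at level 38, left associativity).

Record Category : Type := {
  Ob :> Type;
  Hom : Ob -> Ob -> Type;
  idm : forall A, Hom A A;
  comp : forall A B C, Hom B C -> Hom A B -> Hom A C;
  comp_idl : forall A B (f : Hom A B), comp (idm B) f = f;
  comp_idr : forall A B (f : Hom A B), comp f (idm A) = f;
  comp_assoc : forall A B C D (h : Hom C D) (g : Hom B C) (f : Hom A B),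
      comp h (comp g f) = comp (comp h g) f
}.

Arguments Hom {c} A B.
Arguments idm {c} A.
Arguments comp {c A B C} f g.
Arguments comp_idl {c A B} f.
Arguments comp_idr {c A B} f.
Arguments comp_assoc {c A B C D} h g f.

Notation "A ~> B" := (Hom A B) : type_scope.
(* Applicative order: [f ∘ g] is [g] first, then [f]. *)
Notation "f ∘ g" := (comp f g) : cat_scope.

Record Functor (C D : Category) : Type := {
  fob :> C -> D;
  fmap : forall A B : C, A ~> B -> fob A ~> fob B;
  fmap_id : forall A : C, fmap (idm A) = idm (fob A);
  fmap_comp : forall (A B E : C) (g : B ~> E) (f : A ~> B),
      fmap (g ∘ f) = fmap g ∘ fmap f
}.

Arguments fmap {C D} _ {A B} _.

Definition functor_id (C : Category) : Functor C C :=
  {| fob := fun A => A;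
     fmap := fun A B f => f;
     fmap_id := fun A => eq_refl;
     fmap_comp := fun A B E g f => eq_refl |}.

Program Definition functor_comp (C D E : Category)
    (G : Functor D E) (F : Functor C D) : Functor C E :=
  {| fob := fun A => G (F A);
     fmap := fun A B f => fmap G (fmap F f) |}.
Next Obligation. now rewrite !fmap_id. Qed.
Next Obligation. now rewrite !fmap_comp. Qed.

Record NatIso (C D : Category) (F G : Functor C D) : Type := {
  nat_fwd : forall A : C, F A ~> G A;
  nat_bwd : forall A : C, G A ~> F A;
  nat_natural : forall (A B : C) (f : A ~> B),
      nat_fwd B ∘ fmap F f = fmap G f ∘ nat_fwd A;
  nat_bwd_fwd : forall A : C, nat_bwd A ∘ nat_fwd A = idm (F A);
  nat_fwd_bwd : forall A : C, nat_fwd A ∘ nat_bwd A = idm (G A)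
}.

Record Equivalence (C D : Category) : Type := {
  eqv_fun : Functor C D;
  eqv_inv : Functor D C;
  eqv_unit : NatIso (functor_id C) (functor_comp eqv_inv eqv_fun);
  eqv_counit : NatIso (functor_comp eqv_fun eqv_inv) (functor_id D)
}.

Record MonoidalCategory : Type := {
  mon_cat :> Category;
  tens : mon_cat -> mon_cat -> mon_cat;
  tensm : forall A B A' B' : mon_cat,
      A ~> A' -> B ~> B' -> tens A B ~> tens A' B';
  I1 : mon_cat;
  asc : forall A B C : mon_cat, tens (tens A B) C ~> tens A (tens B C);
  asc_inv : forall A B C : mon_cat, tens A (tens B C) ~> tens (tens A B) C;
  lun : forall A : mon_cat, tens I1 A ~> A;
  lun_inv : forall A : mon_cat, A ~> tens I1 A;
  run : forall A : mon_cat, tens A I1 ~> A;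
  run_inv : forall A : mon_cat, A ~> tens A I1;

  tensm_id : forall A B : mon_cat,
      tensm (idm A) (idm B) = idm (tens A B);
  tensm_comp : forall (A A' A'' B B' B'' : mon_cat)
      (f' : A' ~> A'') (f : A ~> A') (g' : B' ~> B'') (g : B ~> B'),
      tensm (f' ∘ f) (g' ∘ g) = tensm f' g' ∘ tensm f g;

  asc_natural : forall (A A' B B' C C' : mon_cat)
      (f : A ~> A') (g : B ~> B') (h : C ~> C'),
      asc A' B' C' ∘ tensm (tensm f g) h
      = tensm f (tensm g h) ∘ asc A B C;
  asc_inv_asc : forall A B C : mon_cat,
      asc_inv A B C ∘ asc A B C = idm (tens (tens A B) C);
  asc_asc_inv : forall A B C : mon_cat,
      asc A B C ∘ asc_inv A B C = idm (tens A (tens B C));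

  lun_natural : forall (A A' : mon_cat) (f : A ~> A'),
      lun A' ∘ tensm (idm I1) f = f ∘ lun A;
  lun_inv_lun : forall A : mon_cat, lun_inv A ∘ lun A = idm (tens I1 A);
  lun_lun_inv : forall A : mon_cat, lun A ∘ lun_inv A = idm A;

  run_natural : forall (A A' : mon_cat) (f : A ~> A'),
      run A' ∘ tensm f (idm I1) = f ∘ run A;
  run_inv_run : forall A : mon_cat, run_inv A ∘ run A = idm (tens A I1);
  run_run_inv : forall A : mon_cat, run A ∘ run_inv A = idm A;

  triangle : forall A B : mon_cat,
      tensm (idm A) (lun B) ∘ asc A I1 B = tensm (run A) (idm B);
  pentagon : forall A B C D : mon_cat,
      asc A B (tens C D) ∘ asc (tens A B) C D
      = tensm (idm A) (asc B C D) ∘ asc A (tens B C) D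
        ∘ tensm (asc A B C) (idm D)
}.

Arguments tens {m} A B.
Arguments tensm {m A B A' B'} f g.
Arguments I1 {m}.
Arguments asc {m} A B C.
Arguments asc_inv {m} A B C.
Arguments lun {m} A.
Arguments lun_inv {m} A.
Arguments run {m} A.
Arguments run_inv {m} A.

Notation "A ⊗ B" := (tens A B) : cat_scope.
Notation "f ⊠ g" := (tensm f g) : cat_scope.

Record SymMonCategory : Type := {
  smc_mon :> MonoidalCategory;
  braid : forall A B : smc_mon, A ⊗ B ~> B ⊗ A;
  braid_natural : forall (A A' B B' : smc_mon) (f : A ~> A') (g : B ~> B'),
      braid A' B' ∘ (f ⊠ g) = (g ⊠ f) ∘ braid A B;
  braid_invol : forall A B : smc_mon, braid B A ∘ braid A B = idm (A ⊗ B);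
  hexagon : forall A B C : smc_mon,
      asc B C A ∘ braid A (B ⊗ C) ∘ asc A B C
      = (idm B ⊠ braid A C) ∘ asc B A C ∘ (braid A B ⊠ idm C)
}.

Arguments braid {s} A B.

(* [1 ⊗ σ ⊗ 1] with its associators. *)
Definition midswap (C : SymMonCategory) (W X Y Z : C) :
    (W ⊗ X) ⊗ (Y ⊗ Z) ~> (W ⊗ Y) ⊗ (X ⊗ Z) :=
  asc_inv W Y (X ⊗ Z)
  ∘ (idm W ⊠ (asc Y X Z ∘ (braid X Y ⊠ idm Z) ∘ asc_inv X Y Z))
  ∘ asc W X (Y ⊗ Z).

Arguments midswap {C} W X Y Z.

Record Bialgebra (C : SymMonCategory) : Type := {
  bialg_ob :> C;
  mul : bialg_ob ⊗ bialg_ob ~> bialg_ob;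
  unt : I1 ~> bialg_ob;
  comul : bialg_ob ~> bialg_ob ⊗ bialg_ob;
  counit : bialg_ob ~> I1;

  mul_assoc :
    mul ∘ (mul ⊠ idm bialg_ob)
    = mul ∘ (idm bialg_ob ⊠ mul) ∘ asc bialg_ob bialg_ob bialg_ob;
  mul_unitl : mul ∘ (unt ⊠ idm bialg_ob) = lun bialg_ob;
  mul_unitr : mul ∘ (idm bialg_ob ⊠ unt) = run bialg_ob;

  comul_coassoc :
    asc bialg_ob bialg_ob bialg_ob ∘ (comul ⊠ idm bialg_ob) ∘ comul
    = (idm bialg_ob ⊠ comul) ∘ comul;
  comul_counitl :
    lun bialg_ob ∘ (counit ⊠ idm bialg_ob) ∘ comul = idm bialg_ob;
  comul_counitr :
    run bialg_ob ∘ (idm bialg_ob ⊠ counit) ∘ comul = idm bialg_ob;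

  comul_mul :
    comul ∘ mul
    = (mul ⊠ mul) ∘ midswap bialg_ob bialg_ob bialg_ob bialg_ob
      ∘ (comul ⊠ comul);
  comul_unt : comul ∘ unt = (unt ⊠ unt) ∘ lun_inv I1;
  counit_mul : counit ∘ mul = lun I1 ∘ (counit ⊠ counit);
  counit_unt : counit ∘ unt = idm I1
}.

Arguments mul {C} b.
Arguments unt {C} b.
Arguments comul {C} b.
Arguments counit {C} b.

Record HopfAlgebra (C : SymMonCategory) : Type := {
  hopf_bialg :> Bialgebra C;
  antipode : hopf_bialg ~> hopf_bialg;
  antipode_l :
    mul hopf_bialg ∘ (antipode ⊠ idm (hopf_bialg : C)) ∘ comul hopf_bialg
    = unt hopf_bialg ∘ counit hopf_bialg;
  antipode_r :
    mul hopf_bialg ∘ (idm (hopf_bialg : C) ⊠ antipode) ∘ comul hopf_bialg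
    = unt hopf_bialg ∘ counit hopf_bialg
}.

Arguments antipode {C} h.

(* Bialgebra morphisms; compatibility with antipodes is a consequence. *)
Record HopfHom (C : SymMonCategory) (A B : HopfAlgebra C) : Type := {
  hopf_mor :> A ~> B;
  hopf_mul : hopf_mor ∘ mul A = mul B ∘ (hopf_mor ⊠ hopf_mor);
  hopf_unt : hopf_mor ∘ unt A = unt B;
  hopf_comul : comul B ∘ hopf_mor = (hopf_mor ⊠ hopf_mor) ∘ comul A;
  hopf_counit : counit B ∘ hopf_mor = counit A
}.

Lemma hopf_hom_ext (C : SymMonCategory) (A B : HopfAlgebra C)
    (f g : HopfHom A B) : hopf_mor f = hopf_mor g -> f = g.
Proof.
destruct f, g; simpl; intros e; subst; f_equal; apply proof_irrelevance.
Qed.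

Program Definition hopf_id (C : SymMonCategory) (A : HopfAlgebra C) :
    HopfHom A A :=
  {| hopf_mor := idm (A : C) |}.
Next Obligation. now rewrite tensm_id, comp_idl, comp_idr. Qed.
Next Obligation. apply comp_idl. Qed.
Next Obligation. now rewrite tensm_id, comp_idl, comp_idr. Qed.
Next Obligation. apply comp_idr. Qed.

Program Definition hopf_comp (C : SymMonCategory) (A B D : HopfAlgebra C)
    (g : HopfHom B D) (f : HopfHom A B) : HopfHom A D :=
  {| hopf_mor := hopf_mor g ∘ hopf_mor f |}.
Next Obligation.
now rewrite <- comp_assoc, hopf_mul, comp_assoc, hopf_mul, tensm_comp,
  comp_assoc.
Qed.
Next Obligation. now rewrite <- comp_assoc, !hopf_unt. Qed.
Next Obligation.
now rewrite comp_assoc, hopf_comul, <- comp_assoc, hopf_comul, tensm_comp,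
  comp_assoc.
Qed.
Next Obligation. now rewrite comp_assoc, !hopf_counit. Qed.

Record Action (C : SymMonCategory) : Type := {
  act_B : HopfAlgebra C;
  act_X : HopfAlgebra C;
  act : act_B ⊗ act_X ~> act_X;

  act_unit_l : act ∘ (unt act_B ⊠ idm (act_X : C)) = lun (act_X : C);
  act_unit_r :
    act ∘ (idm (act_B : C) ⊠ unt act_X)
    = unt act_X ∘ counit act_B ∘ run (act_B : C);
  act_cocomm :
    (idm (act_B : C) ⊠ act) ∘ asc (act_B : C) act_B act_X
      ∘ (comul act_B ⊠ idm (act_X : C))
    = (idm (act_B : C) ⊠ act) ∘ asc (act_B : C) act_B act_X
      ∘ (braid (act_B : C) act_B ⊠ idm (act_X : C))
      ∘ (comul act_B ⊠ idm (act_X : C));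
  act_counit :
    counit act_X ∘ act = lun I1 ∘ (counit act_B ⊠ counit act_X);
  act_comul :
    comul act_X ∘ act
    = (act ⊠ act) ∘ midswap (act_B : C) act_B act_X act_X
      ∘ (comul act_B ⊠ comul act_X);
  act_act :
    act ∘ (idm (act_B : C) ⊠ act) ∘ asc (act_B : C) act_B act_X
    = act ∘ (mul act_B ⊠ idm (act_X : C));
  act_mul :
    act ∘ (idm (act_B : C) ⊠ mul act_X)
    = mul act_X ∘ (act ⊠ act) ∘ midswap (act_B : C) act_B act_X act_X
      ∘ (comul act_B ⊠ idm ((act_X : C) ⊗ act_X))
}.

Arguments act {C} a.

Record ActionHom (C : SymMonCategory) (a a' : Action C) : Type := {
  ah_g : HopfHom (act_B a) (act_B a');
  ah_v : HopfHom (act_X a) (act_X a');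
  ah_act : ah_v ∘ act a = act a' ∘ (hopf_mor ah_g ⊠ hopf_mor ah_v)
}.

Lemma action_hom_ext (C : SymMonCategory) (a a' : Action C)
    (f f' : ActionHom a a') :
  ah_g f = ah_g f' -> ah_v f = ah_v f' -> f = f'.
Proof.
destruct f, f'; simpl; intros e1 e2; subst; f_equal; apply proof_irrelevance.
Qed.

Program Definition action_id (C : SymMonCategory) (a : Action C) :
    ActionHom a a :=
  {| ah_g := hopf_id (act_B a); ah_v := hopf_id (act_X a) |}.
Next Obligation. now rewrite tensm_id, comp_idl, comp_idr. Qed.

Program Definition action_comp (C : SymMonCategory) (a b c : Action C)
    (f' : ActionHom b c) (f : ActionHom a b) : ActionHom a c :=
  {| ah_g := hopf_comp (ah_g f') (ah_g f);
     ah_v := hopf_comp (ah_v f') (ah_v f) |}.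
Next Obligation.
now rewrite <- comp_assoc, ah_act, comp_assoc, ah_act, tensm_comp, comp_assoc.
Qed.

Program Definition Act (C : SymMonCategory) : Category :=
  {| Ob := Action C;
     Hom := @ActionHom C;
     idm := @action_id C;
     comp := @action_comp C |}.
Next Obligation.
apply action_hom_ext; apply hopf_hom_ext; apply comp_idl.
Qed.
Next Obligation.
apply action_hom_ext; apply hopf_hom_ext; apply comp_idr.
Qed.
Next Obligation.
apply action_hom_ext; apply hopf_hom_ext; apply comp_assoc.
Qed.

Record SplitExtension (C : SymMonCategory) : Type := {
  se_X : HopfAlgebra C;
  se_A : HopfAlgebra C;
  se_B : HopfAlgebra C;
  kappa : HopfHom se_X se_A;
  alpha : HopfHom se_A se_B;
  sect : HopfHom se_B se_A;
  lambda : se_A ~> se_X;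

  lambda_kappa : lambda ∘ kappa = idm (se_X : C);
  alpha_sect : alpha ∘ sect = idm (se_B : C);
  lambda_sect : lambda ∘ sect = unt se_X ∘ counit se_B;
  alpha_kappa : alpha ∘ kappa = unt se_B ∘ counit se_X;
  se_decomp :
    mul se_A ∘ ((kappa ∘ lambda) ⊠ (sect ∘ alpha)) ∘ comul se_A
    = idm (se_A : C);
  lambda_mul :
    lambda ∘ mul se_A ∘ (hopf_mor kappa ⊠ hopf_mor sect)
    = run (se_X : C) ∘ (idm (se_X : C) ⊠ counit se_B);
  se_cocomm :
    (idm (se_B : C) ⊠ lambda) ∘ (idm (se_B : C) ⊠ mul se_A)
      ∘ (idm (se_B : C) ⊠ (hopf_mor sect ⊠ hopf_mor kappa))
      ∘ asc (se_B : C) se_B se_X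
      ∘ (comul se_B ⊠ idm (se_X : C))
    = (idm (se_B : C) ⊠ lambda) ∘ (idm (se_B : C) ⊠ mul se_A)
      ∘ (idm (se_B : C) ⊠ (hopf_mor sect ⊠ hopf_mor kappa))
      ∘ asc (se_B : C) se_B se_X
      ∘ (braid (se_B : C) se_B ⊠ idm (se_X : C))
      ∘ (comul se_B ⊠ idm (se_X : C));
  lambda_comul : comul se_X ∘ lambda = (lambda ⊠ lambda) ∘ comul se_A;
  lambda_counit : counit se_X ∘ lambda = counit se_A;
  lambda_unt : lambda ∘ unt se_A = unt se_X
}.

Arguments kappa {C} s.
Arguments alpha {C} s.
Arguments sect {C} s.
Arguments lambda {C} s.

Record SplitExtHom (C : SymMonCategory) (s s' : SplitExtension C) : Type := {
  sh_g : HopfHom (se_B s) (se_B s');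
  sh_v : HopfHom (se_X s) (se_X s');
  sh_p : HopfHom (se_A s) (se_A s');
  sh_kappa : sh_p ∘ kappa s = kappa s' ∘ sh_v;
  sh_sect : sh_p ∘ sect s = sect s' ∘ sh_g;
  sh_alpha : alpha s' ∘ sh_p = sh_g ∘ alpha s;
  sh_lambda : lambda s' ∘ sh_p = sh_v ∘ lambda s
}.

Lemma split_ext_hom_ext (C : SymMonCategory) (s s' : SplitExtension C)
    (f f' : SplitExtHom s s') :
  sh_g f = sh_g f' -> sh_v f = sh_v f' -> sh_p f = sh_p f' -> f = f'.
Proof.
destruct f, f'; simpl; intros e1 e2 e3; subst; f_equal;
  apply proof_irrelevance.
Qed.

Program Definition split_ext_id (C : SymMonCategory) (s : SplitExtension C) :
    SplitExtHom s s :=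
  {| sh_g := hopf_id (se_B s);
     sh_v := hopf_id (se_X s);
     sh_p := hopf_id (se_A s) |}.
Next Obligation. now rewrite comp_idl, comp_idr. Qed.
Next Obligation. now rewrite comp_idl, comp_idr. Qed.
Next Obligation. now rewrite comp_idl, comp_idr. Qed.
Next Obligation. now rewrite comp_idl, comp_idr. Qed.

Program Definition split_ext_comp (C : SymMonCategory)
    (s t w : SplitExtension C)
    (f' : SplitExtHom t w) (f : SplitExtHom s t) : SplitExtHom s w :=
  {| sh_g := hopf_comp (sh_g f') (sh_g f);
     sh_v := hopf_comp (sh_v f') (sh_v f);
     sh_p := hopf_comp (sh_p f') (sh_p f) |}.
Next Obligation.
now rewrite <- comp_assoc, sh_kappa, comp_assoc, sh_kappa, comp_assoc.
Qed.
Next Obligation.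
now rewrite <- comp_assoc, sh_sect, comp_assoc, sh_sect, comp_assoc.
Qed.
Next Obligation.
now rewrite comp_assoc, sh_alpha, <- comp_assoc, sh_alpha, comp_assoc.
Qed.
Next Obligation.
now rewrite comp_assoc, sh_lambda, <- comp_assoc, sh_lambda, comp_assoc.
Qed.

Program Definition SplitExt (C : SymMonCategory) : Category :=
  {| Ob := SplitExtension C;
     Hom := @SplitExtHom C;
     idm := @split_ext_id C;
     comp := @split_ext_comp C |}.
Next Obligation.
apply split_ext_hom_ext; apply hopf_hom_ext; apply comp_idl.
Qed.
Next Obligation.
apply split_ext_hom_ext; apply hopf_hom_ext; apply comp_idr.
Qed.
Next Obligation.
apply split_ext_hom_ext; apply hopf_hom_ext; apply comp_assoc.
Qed.

(* Main.v *)
(** To a split extension [(X, A, B, κ, α, e, λ)] one attaches the action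
    [b ▷ x = λ(e(b) κ(x))].  The decomposition [a = κλ(a₁) eα(a₂)] yields the
    exchange rule [e(b) κ(x) = κ(b₁ ▷ x) e(b₂)], from which all the axioms of an
    action follow.  Conversely an action makes [τ = (▷ ⊗ 1)(1 ⊗ σ)(Δ ⊗ 1)] a
    distributive law [B ⊗ X -> X ⊗ B], which by the cocommutativity axiom is a
    morphism of coalgebras, so that [X ⊗ B] is a bialgebra; its identity is the
    convolution product of the invertible maps [κλ] and [eα], whence an antipode.
    The exchange rule says precisely that [m(κ ⊗ e) : X ⊗ B -> A], whose inverse
    is [(λ ⊗ α)Δ], is multiplicative.

    Associators and unitors are eliminated by letting an object [A] act as the
    functor [A ⊗ -]: tensor products become composites of functors, which are
    strictly associative and unital, and the functor is faithful. *)

From Stdlib Require Import ssreflect.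
Require Import Defs.

Set Implicit Arguments.
Unset Strict Implicit.
Unset Printing Implicit Defensive.

Local Open Scope cat_scope.

(** * Strictification *)

Section Coherence.

Context {C : SymMonCategory}.

Lemma comp_inv_l (A B D : C) (i : B ~> D) (j : D ~> B) (f g : A ~> B) :
  j ∘ i = idm B -> i ∘ f = i ∘ g -> f = g.
Proof.
intros ji e.
by rewrite -(comp_idl f) -(comp_idl g) -ji -!comp_assoc e.
Qed.

Lemma comp_inv_r (A B D : C) (i : A ~> B) (j : B ~> A) (f g : B ~> D) :
  i ∘ j = idm B -> f ∘ i = g ∘ i -> f = g.
Proof.
intros ij e.
by rewrite -(comp_idr f) -(comp_idr g) -ij !comp_assoc e.
Qed.

Lemma tensm_swap (A A' B B' : C) (f : A ~> A') (g : B ~> B') :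
  (f ⊠ idm B') ∘ (idm A ⊠ g) = (idm A' ⊠ g) ∘ (f ⊠ idm B).
Proof. by rewrite -!tensm_comp !comp_idl !comp_idr. Qed.

(** The unitor is a natural isomorphism from [I1 ⊗ -] to the identity functor, so tensoring with
    [I1] is faithful. *)
Lemma tensm_unit_inj_l (A B : C) (f g : A ~> B) :
  idm (I1 : C) ⊠ f = idm I1 ⊠ g -> f = g.
Proof.
intros e; apply (comp_inv_r (lun_lun_inv A)).
by rewrite -!lun_natural e.
Qed.

Lemma tensm_unit_inj_r (A B : C) (f g : A ~> B) :
  f ⊠ idm (I1 : C) = g ⊠ idm I1 -> f = g.
Proof.
intros e; apply (comp_inv_r (run_run_inv A)).
by rewrite -!run_natural e.
Qed.

(* Kelly's derivation of the left unit triangle from the middle one. *)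
Lemma lun_tens (A B : C) :
  lun (A ⊗ B) ∘ asc I1 A B = lun A ⊠ idm B.
Proof.
apply tensm_unit_inj_l.
apply (comp_inv_r (asc_asc_inv I1 (I1 ⊗ A) B)).
apply (@comp_inv_r _ _ _ (asc I1 I1 A ⊠ idm B) (asc_inv I1 I1 A ⊠ idm B)).
  by rewrite -tensm_comp asc_asc_inv comp_idl tensm_id.
assert (wkc : forall X Y Z (g : Y ~> Z) (f : X ~> Y),
    idm (I1 : C) ⊠ (g ∘ f) = (idm I1 ⊠ g) ∘ (idm I1 ⊠ f)).
  intros; by rewrite -tensm_comp comp_idl.
transitivity (asc I1 A B ∘ ((run I1 ⊠ idm A) ⊠ idm B)).
- rewrite wkc -!comp_assoc (comp_assoc (idm I1 ⊠ asc _ _ _)) -pentagon.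
  by rewrite comp_assoc triangle asc_natural tensm_id.
- by rewrite -triangle -asc_natural -comp_assoc -tensm_comp comp_idl.
Qed.

(** * Tensor words and the functors they denote *)

Inductive word : Type :=
| At (A : C)
| Un
| Te (a b : word).

Fixpoint ev (w : word) : C :=
  match w with At A => A | Un => I1 | Te a b => ev a ⊗ ev b end.

Definition wk (A B D : C) (f : B ~> D) : A ⊗ B ~> A ⊗ D := idm A ⊠ f.

(** [den w] is the functor [ev w ⊗ -] as an iterated composite. Rebracketing a word or inserting
    [Un] leaves it unchanged by computation, so structural isomorphisms lift to endomorphisms. *)
Fixpoint den (w : word) (Z : C) : C :=
  match w with At A => A ⊗ Z | Un => Z | Te a b => den a (den b Z) end.

Fixpoint denm (w : word) (Z Z' : C) (h : Z ~> Z') : den w Z ~> den w Z' :=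
  match w with
  | At A => wk A h
  | Un => h
  | Te a b => denm a (denm b h)
  end.

Fixpoint flat (w : word) (Z : C) : ev w ⊗ Z ~> den w Z :=
  match w with
  | At A => idm (A ⊗ Z)
  | Un => lun Z
  | Te a b => flat a (den b Z) ∘ ((idm (ev a) ⊠ flat b Z) ∘ asc (ev a) (ev b) Z)
  end.

Fixpoint unflat (w : word) (Z : C) : den w Z ~> ev w ⊗ Z :=
  match w with
  | At A => idm (A ⊗ Z)
  | Un => lun_inv Z
  | Te a b =>
      (asc_inv (ev a) (ev b) Z ∘ (idm (ev a) ⊠ unflat b Z)) ∘ unflat a (den b Z)
  end.

Lemma flat_unflat w Z : flat w Z ∘ unflat w Z = idm (den w Z).
Proof.
revert Z; induction w as [A| |a IHa b IHb]; intros Z; simpl.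
- apply comp_idl.
- apply lun_lun_inv.
- rewrite -!comp_assoc (comp_assoc (asc _ _ _)) asc_asc_inv comp_idl.
  rewrite (comp_assoc (_ ⊠ _)) -tensm_comp IHb comp_idl tensm_id.
  by rewrite comp_idl IHa.
Qed.

Lemma unflat_flat w Z : unflat w Z ∘ flat w Z = idm (ev w ⊗ Z).
Proof.
revert Z; induction w as [A| |a IHa b IHb]; intros Z; simpl.
- apply comp_idl.
- apply lun_inv_lun.
- rewrite -!comp_assoc (comp_assoc (unflat _ _)) IHa comp_idl.
  rewrite (comp_assoc (_ ⊠ _)) -tensm_comp IHb comp_idl tensm_id.
  by rewrite comp_idl asc_inv_asc.
Qed.

(** Makes [flat] a natural isomorphism from [ev w ⊗ -] to [den w], along which [lift] transports
    morphisms. *)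
Lemma flat_natural w Z Z' (h : Z ~> Z') :
  flat w Z' ∘ (idm (ev w) ⊠ h) = denm w h ∘ flat w Z.
Proof.
revert Z Z' h; induction w as [A| |a IHa b IHb]; intros Z Z' h; simpl.
- by rewrite comp_idl comp_idr.
- apply lun_natural.
- rewrite -tensm_id -!comp_assoc asc_natural (comp_assoc (_ ⊠ _)).
  rewrite -tensm_comp IHb comp_idl !comp_assoc -IHa -!comp_assoc.
  by rewrite (comp_assoc (_ ⊠ _) (_ ⊠ _)) -tensm_comp comp_idl.
Qed.

Lemma wk_id (A B : C) : wk A (idm B) = idm (A ⊗ B).
Proof. apply tensm_id. Qed.

Lemma wk_comp (A B D E : C) (g : D ~> E) (f : B ~> D) :
  wk A (g ∘ f) = wk A g ∘ wk A f.
Proof. unfold wk; by rewrite -tensm_comp comp_idl. Qed.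

Lemma denm_id w Z : denm w (idm Z) = idm (den w Z).
Proof.
revert Z; induction w as [A| |a IHa b IHb]; intros Z; simpl; trivial.
- apply wk_id.
- by rewrite IHb IHa.
Qed.

Lemma denm_comp w Z Z' Z'' (g : Z' ~> Z'') (f : Z ~> Z') :
  denm w (g ∘ f) = denm w g ∘ denm w f.
Proof.
revert Z Z' Z'' g f; induction w as [A| |a IHa b IHb]; intros; simpl; trivial.
- apply wk_comp.
- by rewrite IHb IHa.
Qed.

(* [lift f] is the natural transformation [f ⊗ -] read between the strictly
   associative composites [den]; structural isomorphisms lift to identities. *)
Definition lift w w' (f : ev w ~> ev w') (Z : C) : den w Z ~> den w' Z :=
  locked (flat w' Z ∘ ((f ⊠ idm Z) ∘ unflat w Z)).

Lemma lift_flat w w' (f : ev w ~> ev w') Z :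
  lift f Z ∘ flat w Z = flat w' Z ∘ (f ⊠ idm Z).
Proof. by rewrite /lift -lock -!comp_assoc unflat_flat comp_idr. Qed.

(** Since [flat] is invertible, one commuting square determines the lift; the basic lifts below are
    computed by exhibiting such a square. *)
Lemma lift_uniq w w' (f : ev w ~> ev w') Z (h : den w Z ~> den w' Z) :
  h ∘ flat w Z = flat w' Z ∘ (f ⊠ idm Z) -> lift f Z = h.
Proof.
intros e; apply (comp_inv_r (flat_unflat w Z)); by rewrite lift_flat.
Qed.

(** Faithfulness, read off at [Z := I1] and [t := flat w I1]. The arbitrary tail [t] lets every rule
    be used in a form continued on the right. *)
Lemma lift_inj w w' (f g : ev w ~> ev w') :
  (forall Z Y (t : Y ~> den w Z), lift f Z ∘ t = lift g Z ∘ t) -> f = g.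
Proof.
intros e; apply tensm_unit_inj_r; apply (comp_inv_l (unflat_flat w' I1)).
rewrite -!lift_flat; apply e.
Qed.

Lemma lift_natural w w' (f : ev w ~> ev w') Z Z' (h : Z ~> Z') :
  lift f Z' ∘ denm w h = denm w' h ∘ lift f Z.
Proof.
apply (comp_inv_r (flat_unflat w Z)).
rewrite -!comp_assoc -flat_natural lift_flat !comp_assoc.
by rewrite lift_flat -flat_natural -!comp_assoc tensm_swap.
Qed.

Lemma lift_id w Z : lift (idm (ev w)) Z = idm (den w Z).
Proof. apply lift_uniq; by rewrite tensm_id comp_idl comp_idr. Qed.

Lemma lift_comp w w' w'' (g : ev w' ~> ev w'') (f : ev w ~> ev w') Z :
  lift (w := w) (w' := w'') (g ∘ f) Z = lift g Z ∘ lift f Z.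
Proof.
apply lift_uniq.
rewrite -comp_assoc lift_flat comp_assoc lift_flat -comp_assoc.
by rewrite -tensm_comp comp_idl.
Qed.

(** Interchange fixes the order: [g] acts on the right wires first, then [f] on the left ones. *)
Lemma lift_tens a a' b b' (f : ev a ~> ev a') (g : ev b ~> ev b') Z :
  lift (w := Te a b) (w' := Te a' b') (f ⊠ g) Z
  = lift f (den b' Z) ∘ denm a (lift g Z).
Proof.
apply lift_uniq; simpl.
rewrite -!comp_assoc (comp_assoc (denm _ _)) -flat_natural.
rewrite -!comp_assoc (comp_assoc (lift _ _)) lift_flat.
rewrite asc_natural -!comp_assoc; apply f_equal.
rewrite !comp_assoc -!tensm_comp !comp_idl !comp_idr.
by rewrite lift_flat.
Qed.

(** The content is the pentagon; for the unitors below it is [lun_tens] and the triangle. *)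
Lemma lift_asc a b d Z :
  lift (w := Te (Te a b) d) (w' := Te a (Te b d)) (asc (ev a) (ev b) (ev d)) Z
  = idm _.
Proof.
apply lift_uniq; rewrite comp_idl; simpl.
rewrite -!comp_assoc; apply f_equal.
rewrite (comp_assoc (asc _ _ _) (_ ⊠ _)) -tensm_id asc_natural.
rewrite -!comp_assoc pentagon !comp_assoc; do 2 f_equal.
by rewrite -!tensm_comp !comp_idl.
Qed.

Lemma lift_inverse w w' (f : ev w ~> ev w') (g : ev w' ~> ev w) Z :
  g ∘ f = idm _ -> lift g Z ∘ lift f Z = idm _.
Proof. intros e; by rewrite -lift_comp e lift_id. Qed.

Lemma lift_asc_inv a b d Z :
  lift (w := Te a (Te b d)) (w' := Te (Te a b) d)
    (asc_inv (ev a) (ev b) (ev d)) Z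
  = idm _.
Proof.
rewrite -(@lift_inverse (Te a (Te b d)) (Te (Te a b) d)
  (asc_inv (ev a) (ev b) (ev d)) (asc (ev a) (ev b) (ev d)) Z).
- apply asc_asc_inv.
- by rewrite lift_asc comp_idl.
Qed.

Lemma lift_lun a Z : lift (w := Te Un a) (w' := a) (lun (ev a)) Z = idm _.
Proof.
apply lift_uniq; rewrite comp_idl; simpl.
by rewrite comp_assoc lun_natural -comp_assoc lun_tens.
Qed.

Lemma lift_lun_inv a Z :
  lift (w := a) (w' := Te Un a) (lun_inv (ev a)) Z = idm _.
Proof.
rewrite -(@lift_inverse a (Te Un a) (lun_inv (ev a)) (lun (ev a)) Z).
- apply lun_lun_inv.
- by rewrite lift_lun comp_idl.
Qed.

Lemma lift_run a Z : lift (w := Te a Un) (w' := a) (run (ev a)) Z = idm _.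
Proof.
apply lift_uniq; rewrite comp_idl; simpl.
by rewrite -triangle.
Qed.

Lemma lift_run_inv a Z :
  lift (w := a) (w' := Te a Un) (run_inv (ev a)) Z = idm _.
Proof.
rewrite -(@lift_inverse a (Te a Un) (run_inv (ev a)) (run (ev a)) Z).
- apply run_run_inv.
- by rewrite lift_run comp_idl.
Qed.

(** * The lifted symmetry *)

Definition swap a b Z : den a (den b Z) ~> den b (den a Z) :=
  lift (w := Te a b) (w' := Te b a) (braid (ev a) (ev b)) Z.

Lemma swap_swap a b Z : swap b a Z ∘ swap a b Z = idm _.
Proof. exact: (@lift_inverse (Te a b) (Te b a) _ _ Z (braid_invol _ _)). Qed.

Lemma swap_natural_l a a' b (f : ev a ~> ev a') Z :
  swap a' b Z ∘ lift f (den b Z) = denm b (lift f Z) ∘ swap a b Z.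
Proof.
transitivity (lift (w := Te a b) (w' := Te b a')
  (braid (ev a') (ev b) ∘ (f ⊠ idm (ev b))) Z).
- rewrite (@lift_comp _ (Te a' b)) lift_tens lift_id denm_id.
  by rewrite comp_idr.
- rewrite braid_natural (@lift_comp _ (Te b a)) lift_tens lift_id.
  by rewrite comp_idl.
Qed.

Lemma swap_natural_r a b b' (f : ev b ~> ev b') Z :
  swap a b' Z ∘ denm a (lift f Z) = lift f (den a Z) ∘ swap a b Z.
Proof.
transitivity (lift (w := Te a b) (w' := Te b' a)
  (braid (ev a) (ev b') ∘ (idm (ev a) ⊠ f)) Z).
- rewrite (@lift_comp _ (Te a b')) lift_tens lift_id.
  by rewrite comp_idl.
- rewrite braid_natural (@lift_comp _ (Te b a)) lift_tens lift_id denm_id.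
  by rewrite comp_idr.
Qed.

(** The hexagon, with its associators lifted to identities. *)
Lemma swap_tens_r a b d Z :
  swap a (Te b d) Z = denm b (swap a d Z) ∘ swap a b (den d Z).
Proof.
pose proof (f_equal (fun f => lift (w := Te (Te a b) d) (w' := Te b (Te d a)) f Z)
  (hexagon (ev a) (ev b) (ev d))) as e; simpl in e.
rewrite (@lift_comp _ (Te a (Te b d))) lift_asc in e.
rewrite (@lift_comp _ (Te (Te b d) a)) lift_asc in e.
rewrite (@lift_comp _ (Te (Te b a) d)) in e.
rewrite (@lift_comp _ (Te b (Te a d))) lift_asc in e.
rewrite lift_tens (@lift_tens (Te a b) (Te b a)) !lift_id denm_id in e.
rewrite comp_idl !comp_idr comp_idl in e.
exact e.
Qed.

(** The second hexagon, obtained from the first by inverting the symmetry. *)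
Lemma swap_tens_l a b d Z :
  swap (Te a b) d Z = swap a d (den b Z) ∘ denm a (swap b d Z).
Proof.
apply (comp_inv_l (swap_swap d (Te a b) Z)).
rewrite swap_swap swap_tens_r -comp_assoc.
rewrite (comp_assoc (swap d a _)) swap_swap comp_idl.
by rewrite /= -denm_comp swap_swap denm_id.
Qed.

(** Naturality along [lun I1] makes this map idempotent, and an invertible idempotent is the
    identity. *)
Lemma swap_unit_r a Z : swap a Un Z = idm _.
Proof.
pose proof (swap_natural_r a (b := Te Un Un) (b' := Un) (lun I1) Z) as e.
rewrite !(lift_lun Un) denm_id comp_idr comp_idl swap_tens_r in e.
simpl in e; rewrite -{1}(comp_idr (swap a Un Z)) in e.
symmetry; exact: (comp_inv_l (swap_swap a Un Z) e).
Qed.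

Lemma swap_unit_l a Z : swap Un a Z = idm _.
Proof.
rewrite -(swap_swap Un a Z) swap_unit_r; symmetry; apply comp_idl.
Qed.

End Coherence.

Arguments word : clear implicits.
Arguments At {C} A.
Arguments Un {C}.

(** * Whiskered composites *)

Notation "A ◁ f" := (wk A f) (at level 37, right associativity) : cat_scope.

Section Layers.

Context {C : SymMonCategory}.
Implicit Types A B D E Z : C.

(* The two digits count the input and output wires. *)
Definition l11 A D (f : A ~> D) Z : A ⊗ Z ~> D ⊗ Z :=
  lift (w := At A) (w' := At D) f Z.
Definition l21 A B D (f : A ⊗ B ~> D) Z : A ⊗ (B ⊗ Z) ~> D ⊗ Z :=
  lift (w := Te (At A) (At B)) (w' := At D) f Z.
Definition l12 A B D (f : A ~> B ⊗ D) Z : A ⊗ Z ~> B ⊗ (D ⊗ Z) :=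
  lift (w := At A) (w' := Te (At B) (At D)) f Z.
Definition l22 A B D E (f : A ⊗ B ~> D ⊗ E) Z : A ⊗ (B ⊗ Z) ~> D ⊗ (E ⊗ Z) :=
  lift (w := Te (At A) (At B)) (w' := Te (At D) (At E)) f Z.
Definition l01 A (f : I1 ~> A) Z : Z ~> A ⊗ Z :=
  lift (w := Un) (w' := At A) f Z.
Definition l10 A (f : A ~> I1) Z : A ⊗ Z ~> Z :=
  lift (w := At A) (w' := Un) f Z.
Definition sw A B Z : A ⊗ (B ⊗ Z) ~> B ⊗ (A ⊗ Z) := swap (At A) (At B) Z.

Section Naturality.
Context {Z Z' : C} (h : Z ~> Z').

(** The [exch] family is the interchange law: an operation on the left wires commutes with any [h]
    on the remaining ones. *)
Lemma exch11 A D (f : A ~> D) : l11 f Z' ∘ A ◁ h = D ◁ h ∘ l11 f Z.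
Proof. exact (@lift_natural C (At A) (At D) f Z Z' h). Qed.
Lemma exch21 A B D (f : A ⊗ B ~> D) :
  l21 f Z' ∘ A ◁ B ◁ h = D ◁ h ∘ l21 f Z.
Proof. exact (@lift_natural C (Te (At A) (At B)) (At D) f Z Z' h). Qed.
Lemma exch12 A B D (f : A ~> B ⊗ D) :
  l12 f Z' ∘ A ◁ h = B ◁ D ◁ h ∘ l12 f Z.
Proof. exact (@lift_natural C (At A) (Te (At B) (At D)) f Z Z' h). Qed.
Lemma exch22 A B D E (f : A ⊗ B ~> D ⊗ E) :
  l22 f Z' ∘ A ◁ B ◁ h = D ◁ E ◁ h ∘ l22 f Z.
Proof.
exact (@lift_natural C (Te (At A) (At B)) (Te (At D) (At E)) f Z Z' h).
Qed.
Lemma exch01 A (f : I1 ~> A) : l01 f Z' ∘ h = A ◁ h ∘ l01 f Z.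
Proof. exact (@lift_natural C Un (At A) f Z Z' h). Qed.
Lemma exch10 A (f : A ~> I1) : l10 f Z' ∘ A ◁ h = h ∘ l10 f Z.
Proof. exact (@lift_natural C (At A) Un f Z Z' h). Qed.
Lemma exch_sw A B : sw A B Z' ∘ A ◁ B ◁ h = B ◁ A ◁ h ∘ sw A B Z.
Proof.
exact (@lift_natural C (Te (At A) (At B)) (Te (At B) (At A)) _ Z Z' h).
Qed.
End Naturality.

Lemma sw_sw A B Z : sw B A Z ∘ sw A B Z = idm _.
Proof. exact (swap_swap (At A) (At B) Z). Qed.

(** The [sw_r] and [sw_l] families slide an operation through a crossing with a strand [A]; crossing
    two wires splits into two elementary crossings. *)
Lemma sw_r11 A B D (f : B ~> D) Z :
  sw A D Z ∘ A ◁ l11 f Z = l11 f (A ⊗ Z) ∘ sw A B Z.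
Proof. exact (@swap_natural_r C (At A) (At B) (At D) f Z). Qed.
Lemma sw_l11 A B D (f : B ~> D) Z :
  sw D A Z ∘ l11 f (A ⊗ Z) = A ◁ l11 f Z ∘ sw B A Z.
Proof. exact (@swap_natural_l C (At B) (At D) (At A) f Z). Qed.

Lemma sw_r21 A B1 B2 D (f : B1 ⊗ B2 ~> D) Z :
  sw A D Z ∘ A ◁ l21 f Z
  = l21 f (A ⊗ Z) ∘ (B1 ◁ sw A B2 Z ∘ sw A B1 (B2 ⊗ Z)).
Proof.
pose proof (@swap_natural_r C (At A) (Te (At B1) (At B2)) (At D) f Z) as e.
rewrite swap_tens_r in e; exact e.
Qed.
Lemma sw_l21 A B1 B2 D (f : B1 ⊗ B2 ~> D) Z :
  sw D A Z ∘ l21 f (A ⊗ Z)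
  = A ◁ l21 f Z ∘ (sw B1 A (B2 ⊗ Z) ∘ B1 ◁ sw B2 A Z).
Proof.
pose proof (@swap_natural_l C (Te (At B1) (At B2)) (At D) (At A) f Z) as e.
rewrite swap_tens_l in e; exact e.
Qed.

Lemma sw_r12 A B D1 D2 (f : B ~> D1 ⊗ D2) Z :
  l12 f (A ⊗ Z) ∘ sw A B Z
  = D1 ◁ sw A D2 Z ∘ (sw A D1 (D2 ⊗ Z) ∘ A ◁ l12 f Z).
Proof.
pose proof (@swap_natural_r C (At A) (At B) (Te (At D1) (At D2)) f Z) as e.
rewrite swap_tens_r -comp_assoc in e; exact (eq_sym e).
Qed.
Lemma sw_l12 A B D1 D2 (f : B ~> D1 ⊗ D2) Z :
  A ◁ l12 f Z ∘ sw B A Z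
  = sw D1 A (D2 ⊗ Z) ∘ (D1 ◁ sw D2 A Z ∘ l12 f (A ⊗ Z)).
Proof.
pose proof (@swap_natural_l C (At B) (Te (At D1) (At D2)) (At A) f Z) as e.
rewrite swap_tens_l -comp_assoc in e; exact (eq_sym e).
Qed.

Lemma sw_r22 A B1 B2 D1 D2 (f : B1 ⊗ B2 ~> D1 ⊗ D2) Z :
  D1 ◁ sw A D2 Z ∘ (sw A D1 (D2 ⊗ Z) ∘ A ◁ l22 f Z)
  = l22 f (A ⊗ Z) ∘ (B1 ◁ sw A B2 Z ∘ sw A B1 (B2 ⊗ Z)).
Proof.
pose proof (@swap_natural_r C (At A) (Te (At B1) (At B2))
  (Te (At D1) (At D2)) f Z) as e.
rewrite !swap_tens_r -comp_assoc in e; exact e.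
Qed.
Lemma sw_l22 A B1 B2 D1 D2 (f : B1 ⊗ B2 ~> D1 ⊗ D2) Z :
  sw D1 A (D2 ⊗ Z) ∘ (D1 ◁ sw D2 A Z ∘ l22 f (A ⊗ Z))
  = A ◁ l22 f Z ∘ (sw B1 A (B2 ⊗ Z) ∘ B1 ◁ sw B2 A Z).
Proof.
pose proof (@swap_natural_l C (Te (At B1) (At B2))
  (Te (At D1) (At D2)) (At A) f Z) as e.
rewrite !swap_tens_l -comp_assoc in e; exact e.
Qed.

Lemma sw_r01 A B (f : I1 ~> B) Z : sw A B Z ∘ A ◁ l01 f Z = l01 f (A ⊗ Z).
Proof.
pose proof (@swap_natural_r C (At A) Un (At B) f Z) as e.
rewrite swap_unit_r comp_idr in e; exact e.
Qed.
Lemma sw_l01 A B (f : I1 ~> B) Z : sw B A Z ∘ l01 f (A ⊗ Z) = A ◁ l01 f Z.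
Proof.
pose proof (@swap_natural_l C Un (At B) (At A) f Z) as e.
rewrite swap_unit_l comp_idr in e; exact e.
Qed.
Lemma sw_r10 A B (f : B ~> I1) Z : l10 f (A ⊗ Z) ∘ sw A B Z = A ◁ l10 f Z.
Proof.
pose proof (@swap_natural_r C (At A) (At B) Un f Z) as e.
rewrite swap_unit_r comp_idl in e; exact (eq_sym e).
Qed.
Lemma sw_l10 A B (f : B ~> I1) Z : A ◁ l10 f Z ∘ sw B A Z = l10 f (A ⊗ Z).
Proof.
pose proof (@swap_natural_l C (At B) Un (At A) f Z) as e.
rewrite swap_unit_l comp_idl in e; exact (eq_sym e).
Qed.

Lemma wk1 A B D (g k : B ~> D) : g = k -> A ◁ g = A ◁ k.
Proof. by move->. Qed.
Lemma wk2 A B D E (g : D ~> E) (f : B ~> D) k :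
  g ∘ f = k -> A ◁ g ∘ A ◁ f = A ◁ k.
Proof. by move<-; rewrite wk_comp. Qed.
Lemma wk3 A B D E F (h : E ~> F) (g : D ~> E) (f : B ~> D) k :
  h ∘ (g ∘ f) = k -> A ◁ h ∘ (A ◁ g ∘ A ◁ f) = A ◁ k.
Proof. by move<-; rewrite !wk_comp. Qed.
Lemma wk4 A B D E F G (l : F ~> G) (h : E ~> F) (g : D ~> E) (f : B ~> D) k :
  l ∘ (h ∘ (g ∘ f)) = k -> A ◁ l ∘ (A ◁ h ∘ (A ◁ g ∘ A ◁ f)) = A ◁ k.
Proof. by move<-; rewrite !wk_comp. Qed.

Lemma post2 B D E (g : D ~> E) (f : B ~> D) k :
  g ∘ f = k -> forall Q (t : Q ~> B), g ∘ (f ∘ t) = k ∘ t.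
Proof. by move=> <- Q t; rewrite !comp_assoc. Qed.
Lemma post3 B D E F (h : E ~> F) (g : D ~> E) (f : B ~> D) k :
  h ∘ (g ∘ f) = k -> forall Q (t : Q ~> B), h ∘ (g ∘ (f ∘ t)) = k ∘ t.
Proof. by move=> <- Q t; rewrite !comp_assoc. Qed.
Lemma post4 B D E F G (l : F ~> G) (h : E ~> F) (g : D ~> E) (f : B ~> D) k :
  l ∘ (h ∘ (g ∘ f)) = k ->
  forall Q (t : Q ~> B), l ∘ (h ∘ (g ∘ (f ∘ t))) = k ∘ t.
Proof. by move=> <- Q t; rewrite !comp_assoc. Qed.

End Layers.

(** * Translation into whiskered composites and rewriting under whiskering *)

Ltac reify X :=
  lazymatch X with
  | @tens _ ?a ?b =>
      let a' := reify a in let b' := reify b in constr:(Te a' b')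
  | @I1 (smc_mon ?C) => constr:(@Un C)
  | _ => constr:(At X)
  end.

Ltac lift_step :=
  match goal with
  | |- context [@lift ?C ?w ?w' (@comp _ ?A ?B ?D ?g ?f) ?Z] =>
      let v := reify B in
      rewrite (@lift_comp C w v w' g f Z)
  | |- context [@lift ?C (Te ?a ?b) (Te ?a' ?b') (@tensm _ _ _ _ _ ?f ?g) ?Z] =>
      rewrite (@lift_tens C a a' b b' f g Z)
  | |- context [@lift ?C ?w _ (@idm _ _) ?Z] => rewrite (@lift_id C w Z)
  | |- context [@lift ?C (Te (Te ?a ?b) ?d) _ (@asc _ _ _ _) ?Z] =>
      rewrite (@lift_asc C a b d Z)
  | |- context [@lift ?C (Te ?a (Te ?b ?d)) _ (@asc_inv _ _ _ _) ?Z] =>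
      rewrite (@lift_asc_inv C a b d Z)
  | |- context [@lift ?C _ ?a (@lun _ _) ?Z] => rewrite (@lift_lun C a Z)
  | |- context [@lift ?C ?a _ (@lun_inv _ _) ?Z] => rewrite (@lift_lun_inv C a Z)
  | |- context [@lift ?C _ ?a (@run _ _) ?Z] => rewrite (@lift_run C a Z)
  | |- context [@lift ?C ?a _ (@run_inv _ _) ?Z] => rewrite (@lift_run_inv C a Z)
  | |- context [@lift ?C (Te ?a ?b) ?w (@braid ?S ?A ?B) ?Z] =>
      change (@lift C (Te a b) w (@braid S A B) Z) with (@swap C a b Z)
  end.

Ltac fold_step :=
  match goal with
  | |- context [@swap ?C (At ?A) (At ?B) ?Z] =>
      change (@swap C (At A) (At B) Z) with (@sw C A B Z)
  | |- context [@swap ?C ?a (Te ?b ?d) ?Z] => rewrite (@swap_tens_r C a b d Z)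
  | |- context [@swap ?C (Te ?a ?b) ?d ?Z] => rewrite (@swap_tens_l C a b d Z)
  | |- context [@lift ?C (At ?A) (At ?B) ?f ?Z] =>
      change (@lift C (At A) (At B) f Z) with (@l11 C A B f Z)
  | |- context [@lift ?C (Te (At ?A) (At ?B)) (At ?D) ?f ?Z] =>
      change (@lift C (Te (At A) (At B)) (At D) f Z) with (@l21 C A B D f Z)
  | |- context [@lift ?C (At ?A) (Te (At ?B) (At ?D)) ?f ?Z] =>
      change (@lift C (At A) (Te (At B) (At D)) f Z) with (@l12 C A B D f Z)
  | |- context [@lift ?C (Te (At ?A) (At ?B)) (Te (At ?D) (At ?E)) ?f ?Z] =>
      change (@lift C (Te (At A) (At B)) (Te (At D) (At E)) f Z)
        with (@l22 C A B D E f Z)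
  | |- context [@lift ?C Un (At ?A) ?f ?Z] =>
      change (@lift C Un (At A) f Z) with (@l01 C A f Z)
  | |- context [@lift ?C (At ?A) Un ?f ?Z] =>
      change (@lift C (At A) Un f Z) with (@l10 C A f Z)
  end.

Ltac nf :=
  repeat first [rewrite wk_comp | rewrite wk_id | rewrite comp_idl
               | rewrite comp_idr | rewrite -comp_assoc].

Ltac push :=
  unfold midswap; repeat lift_step; repeat fold_step; cbn [den denm ev]; nf.

(** An equation in [C] is proved on lifts, by faithfulness; [from] goes the other way and turns an
    axiom into an equation of lifts. *)
Ltac layer :=
  lazymatch goal with
  | |- @eq (@Hom _ ?X ?Y) ?f ?g =>
      let Z := fresh "Z" in let Q := fresh "Q" in let t := fresh "t" in
      let a := reify X in let b := reify Y in
      apply (@lift_inj _ a b f g); intros Z Q t; push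
  end.

Ltac from H :=
  lazymatch type of H with
  | @eq (@Hom _ ?X ?Y) ?f ?g =>
      lazymatch goal with |- forall Z, _ =>
        let Z := fresh "Z" in
        intros Z;
        let a := reify X in let b := reify Y in
        generalize (f_equal (fun k => @lift _ a b k Z) H); cbv beta; push;
        exact (fun e => e)
      end
  end.

(* Equations are carried under their quantifiers to [A ◁ _] and to chains
   continued on the right, so that [rw] rewrites inside a composite at any
   depth of whiskering; [rwr] rewrites from right to left, and the suffix [1]
   restricts to occurrences under at least one [A ◁ _]. *)
Ltac wk_of L :=
  lazymatch type of L with
  | forall x : ?T, _ =>
      let y := fresh in
      constr:(fun y : T => ltac:(let r := wk_of constr:(L y) in exact r))
  | comp _ (comp _ (comp _ _)) = _ => let A := fresh in constr:(fun A => wk4 A L)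
  | comp _ (comp _ _) = _ => let A := fresh in constr:(fun A => wk3 A L)
  | comp _ _ = _ => let A := fresh in constr:(fun A => wk2 A L)
  | _ => let A := fresh in constr:(fun A => wk1 A L)
  end.

Ltac post_of L :=
  lazymatch type of L with
  | forall x : ?T, _ =>
      let y := fresh in
      constr:(fun y : T => ltac:(let r := post_of constr:(L y) in exact r))
  | comp _ (comp _ (comp _ _)) = _ => constr:(post4 L)
  | comp _ (comp _ _) = _ => constr:(post3 L)
  | comp _ _ = _ => constr:(post2 L)
  | _ => constr:(L)
  end.

Ltac sym_of L :=
  lazymatch type of L with
  | forall x : ?T, _ =>
      let y := fresh in
      constr:(fun y : T => ltac:(let r := sym_of constr:(L y) in exact r))
  | _ => constr:(eq_sym L)
  end.

#[local] Unset SsrRewrite.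

Ltac rw_depth n L :=
  first [ let P := post_of L in rewrite P
        | rewrite L
        | lazymatch n with S ?m => let L' := wk_of L in rw_depth m L' end ].

Ltac at_goal L :=
  lazymatch type of L with
  | forall c : SymMonCategory, _ =>
      lazymatch goal with
      | |- @eq (@Hom (mon_cat (smc_mon ?C)) _ _) _ _ => constr:(L C)
      end
  | _ => constr:(L)
  end.

Tactic Notation "rw" constr(L) := let L' := at_goal L in rw_depth 7 L'; nf.
Tactic Notation "rwr" constr(L) :=
  let L' := at_goal L in let L'' := sym_of L' in rw_depth 7 L''; nf.
Tactic Notation "rw1" constr(L) :=
  let L' := at_goal L in let L1 := wk_of L' in rw_depth 6 L1; nf.
Tactic Notation "rwr1" constr(L) :=
  let L' := at_goal L in let L'' := sym_of L' in
  let L1 := wk_of L'' in rw_depth 6 L1; nf.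

(** * Actions and the distributive law *)

Section BialgebraLayers.
Context {C : SymMonCategory} (H : Bialgebra C).

Lemma layer_mul_assoc : forall Z, l21 (mul H) Z ∘ l21 (mul H) (H ⊗ Z)
  = l21 (mul H) Z ∘ H ◁ l21 (mul H) Z.
Proof. from (mul_assoc H). Qed.
Lemma layer_mul_unitl : forall Z, l21 (mul H) Z ∘ l01 (unt H) (H ⊗ Z) = idm _.
Proof. from (mul_unitl H). Qed.
Lemma layer_mul_unitr : forall Z, l21 (mul H) Z ∘ H ◁ l01 (unt H) Z = idm _.
Proof. from (mul_unitr H). Qed.
Lemma layer_comul_coassoc : forall Z, l12 (comul H) (H ⊗ Z) ∘ l12 (comul H) Z
  = H ◁ l12 (comul H) Z ∘ l12 (comul H) Z.
Proof. from (comul_coassoc H). Qed.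
Lemma layer_comul_counitl : forall Z,
  l10 (counit H) (H ⊗ Z) ∘ l12 (comul H) Z = idm _.
Proof. from (comul_counitl H). Qed.
Lemma layer_comul_counitr : forall Z, H ◁ l10 (counit H) Z ∘ l12 (comul H) Z = idm _.
Proof. from (comul_counitr H). Qed.
Lemma layer_comul_mul : forall Z, l12 (comul H) Z ∘ l21 (mul H) Z
  = l21 (mul H) (H ⊗ Z) ∘ (H ◁ H ◁ l21 (mul H) Z ∘ (H ◁ sw H H (H ⊗ Z)
    ∘ (l12 (comul H) (H ⊗ (H ⊗ Z)) ∘ H ◁ l12 (comul H) Z))).
Proof. from (comul_mul H). Qed.
Lemma layer_comul_unt : forall Z, l12 (comul H) Z ∘ l01 (unt H) Z
  = l01 (unt H) (H ⊗ Z) ∘ l01 (unt H) Z.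
Proof. from (comul_unt H). Qed.
Lemma layer_counit_mul : forall Z, l10 (counit H) Z ∘ l21 (mul H) Z
  = l10 (counit H) Z ∘ H ◁ l10 (counit H) Z.
Proof. from (counit_mul H). Qed.
Lemma layer_counit_unt : forall Z, l10 (counit H) Z ∘ l01 (unt H) Z = idm Z.
Proof. from (counit_unt H). Qed.

End BialgebraLayers.

(* Interchange: in a composite the operation on the left wires goes first. *)
Ltac interchange g h :=
  lazymatch g with
  | @wk _ ?A _ _ ?g' =>
      lazymatch h with
      | @wk _ A _ _ ?h' => let e := interchange g' h' in constr:(wk2 A e)
      end
  | l01 ?f _ => constr:(exch01 h f)
  | _ =>
      lazymatch h with
      | wk _ ?k =>
          lazymatch g with
          | l11 ?f _ => constr:(exch11 k f)
          | l12 ?f _ => constr:(exch12 k f)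
          | l10 ?f _ => constr:(exch10 k f)
          | _ =>
              lazymatch k with
              | wk _ ?k' =>
                  lazymatch g with
                  | l21 ?f _ => constr:(exch21 k' f)
                  | l22 ?f _ => constr:(exch22 k' f)
                  | sw ?A ?B _ => constr:(exch_sw k' A B)
                  end
              end
          end
      end
  end.

(** Applied to both sides of an equation, this removes differences in the order of independent
    operations. *)
Ltac slide :=
  repeat
    match goal with
    | |- context [@comp _ _ _ _ ?g (@comp _ _ _ _ ?h ?t)] =>
        let e := interchange g h in rewrite (post2 e t); nf
    | |- context [@comp _ _ _ _ ?g ?h] =>
        let e := interchange g h in rewrite e; nf
    end.

Section ActionLayers.
Context {C : SymMonCategory} (a : Action C).

Notation B := (bialg_ob (hopf_bialg (act_B a))).
Notation X := (bialg_ob (hopf_bialg (act_X a))).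
Notation HB := (hopf_bialg (act_B a)).
Notation HX := (hopf_bialg (act_X a)).

Lemma layer_act_unit_l : forall Z, l21 (act a) Z ∘ l01 (unt HB) (X ⊗ Z) = idm _.
Proof. from (act_unit_l a). Qed.
Lemma layer_act_unit_r : forall Z, l21 (act a) Z ∘ B ◁ l01 (unt HX) Z
  = l01 (unt HX) Z ∘ l10 (counit HB) Z.
Proof. from (act_unit_r a). Qed.
Lemma layer_act_cocomm : forall Z, B ◁ l21 (act a) Z ∘ l12 (comul HB) (X ⊗ Z)
  = B ◁ l21 (act a) Z ∘ (sw B B (X ⊗ Z) ∘ l12 (comul HB) (X ⊗ Z)).
Proof. from (act_cocomm a). Qed.
Lemma layer_act_counit : forall Z, l10 (counit HX) Z ∘ l21 (act a) Z
  = l10 (counit HB) Z ∘ B ◁ l10 (counit HX) Z.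
Proof. from (act_counit a). Qed.
Lemma layer_act_comul : forall Z, l12 (comul HX) Z ∘ l21 (act a) Z
  = l21 (act a) (X ⊗ Z) ∘ (B ◁ X ◁ l21 (act a) Z ∘ (B ◁ sw B X (X ⊗ Z)
    ∘ (l12 (comul HB) (X ⊗ (X ⊗ Z)) ∘ B ◁ l12 (comul HX) Z))).
Proof. from (act_comul a). Qed.
Lemma layer_act_act : forall Z, l21 (act a) Z ∘ B ◁ l21 (act a) Z
  = l21 (act a) Z ∘ l21 (mul HB) (X ⊗ Z).
Proof. from (act_act a). Qed.
Lemma layer_act_mul : forall Z, l21 (act a) Z ∘ B ◁ l21 (mul HX) Z
  = l21 (mul HX) Z ∘ (l21 (act a) (X ⊗ Z) ∘ (B ◁ X ◁ l21 (act a) Z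
    ∘ (B ◁ sw B X (X ⊗ Z) ∘ l12 (comul HB) (X ⊗ (X ⊗ Z))))).
Proof. from (act_mul a). Qed.

(** In elements, [b ⊗ x] goes to [(b₁ ▷ x) ⊗ b₂]: the rule for moving [b] past [x] in the smash
    product. *)
Definition tau : B ⊗ X ~> X ⊗ B :=
  (act a ⊠ idm B) ∘ asc_inv B X B ∘ (idm B ⊠ braid B X) ∘ asc B B X
  ∘ (comul HB ⊠ idm X).

Lemma tauE Z :
  l22 tau Z = l21 (act a) (B ⊗ Z) ∘ (B ◁ sw B X Z ∘ l12 (comul HB) (X ⊗ Z)).
Proof. unfold l22, tau; push; reflexivity. Qed.

(** This and the next three lemmas are the laws of a distributive law. Products of [B] pass because
    [Δ] is multiplicative and [▷] is associative, products of [X] because [▷] distributes over them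
    along [Δ]. *)
Lemma tau_unt_l Z : l22 tau Z ∘ l01 (unt HB) (X ⊗ Z) = X ◁ l01 (unt HB) Z.
Proof.
rewrite tauE; nf. rw @layer_comul_unt. rwr @exch01. rw @sw_l01.
rw @layer_act_unit_l. reflexivity.
Qed.

Lemma tau_unt_r Z : l22 tau Z ∘ B ◁ l01 (unt HX) Z = l01 (unt HX) (B ⊗ Z).
Proof.
rewrite tauE; nf. rw @exch12. rw @sw_r01. rw @layer_act_unit_r.
rw @layer_comul_counitl. reflexivity.
Qed.

Lemma tau_mul_l Z : l22 tau Z ∘ l21 (mul HB) (X ⊗ Z)
  = X ◁ l21 (mul HB) Z ∘ (l22 tau (B ⊗ Z) ∘ B ◁ l22 tau Z).
Proof.
rewrite !tauE; nf. rw @layer_comul_mul. rwr @exch21. rw @sw_l21.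
rw @exch12. rw @sw_r21. rw @layer_act_act. slide. reflexivity.
Qed.

Lemma tau_mul_r Z : l22 tau Z ∘ B ◁ l21 (mul HX) Z
  = l21 (mul HX) (B ⊗ Z) ∘ (X ◁ l22 tau Z ∘ l22 tau (X ⊗ Z)).
Proof.
rewrite !tauE; nf. rw @exch12. rw @sw_r21. rw @layer_act_mul.
rwr @exch21. rw @sw_l12. rwr @layer_comul_coassoc. slide. reflexivity.
Qed.

(* This is where cocommutativity enters. *)
Lemma tauE_braided Z :
  l22 tau Z = sw B X Z ∘ (B ◁ l21 (act a) Z ∘ l12 (comul HB) (X ⊗ Z)).
Proof. rw @layer_act_cocomm. rw @sw_r21. rw @sw_sw. apply tauE. Qed.
(** In elements the sides are [(b₁ ▷ x₁) ⊗ (b₂ ▷ x₂) ⊗ b₃ ⊗ b₄] and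
    [(b₁ ▷ x₁) ⊗ (b₃ ▷ x₂) ⊗ b₂ ⊗ b₄]; cocommutativity exchanges the roles of [b₂] and [b₃]. *)
Lemma tau_comul Z : X ◁ X ◁ l12 (comul HB) Z ∘ (l12 (comul HX) (B ⊗ Z) ∘ l22 tau Z)
  = X ◁ sw B X (B ⊗ Z) ∘ (l22 tau (X ⊗ (B ⊗ Z)) ∘ (B ◁ X ◁ l22 tau Z
    ∘ (B ◁ sw B X (X ⊗ Z) ∘ (B ◁ B ◁ l12 (comul HX) Z ∘ l12 (comul HB) (X ⊗ Z))))).
Proof.
rwr @exch12. rewrite !tauE; nf.
rwr @exch21. rw @sw_l12. rw @layer_act_comul. rw @sw_r12. rw @sw_r12.
rwr @exch21.
symmetry. repeat rw @exch12. rw @sw_l12. repeat rw @exch12.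
repeat rw @layer_comul_coassoc.
apply f_equal. rwr1 @layer_comul_coassoc. do 3 rwr1 @exch12. do 2 rw @exch_sw.
rwr @sw_l12. rwr1 @exch12.
rwr1 @exch12. symmetry. rw @exch_sw. rwr @sw_l12.
(* One side contains the braided expression of [tau], the other the defining one. *)
rwr @tauE_braided. rwr @tauE. rw @exch_sw. reflexivity. Qed.
Lemma tau_counit Z : l10 (counit HB) Z ∘ (l10 (counit HX) (B ⊗ Z) ∘ l22 tau Z)
  = l10 (counit HX) Z ∘ l10 (counit HB) (X ⊗ Z).
Proof.
rwr @exch10. rewrite tauE; nf. rwr @exch21. rw @sw_l10. rw @layer_comul_counitr.
rw @layer_act_counit. rw @exch10.
reflexivity.
Qed.

(** * Smash product algebra and tensor product coalgebra on [X ⊗ B] *)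

Definition sd_mul : (X ⊗ B) ⊗ (X ⊗ B) ~> X ⊗ B :=
  (mul HX ⊠ mul HB) ∘ asc_inv X X (B ⊗ B)
  ∘ (idm X ⊠ (asc X B B ∘ (tau ⊠ idm B) ∘ asc_inv B X B))
  ∘ asc X B (X ⊗ B).
Definition sd_unt : I1 ~> X ⊗ B := (unt HX ⊠ unt HB) ∘ lun_inv I1.
Definition sd_comul : X ⊗ B ~> (X ⊗ B) ⊗ (X ⊗ B) :=
  midswap X X B B ∘ (comul HX ⊠ comul HB).
Definition sd_counit : X ⊗ B ~> I1 := lun I1 ∘ (counit HX ⊠ counit HB).

Notation A := (Te (At X) (At B)).

(** [X ⊗ B] enters as a two-letter word, so that its structure maps act on separate wires [X] and
    [B]. *)
Lemma sd_mulE Z : lift (w := Te A A) (w' := A) sd_mul Z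
  = l21 (mul HX) (B ⊗ Z) ∘ (X ◁ X ◁ l21 (mul HB) Z ∘ X ◁ l22 tau (B ⊗ Z)).
Proof. unfold sd_mul; push; reflexivity. Qed.
Lemma sd_untE Z : lift (w := Un) (w' := A) sd_unt Z
  = l01 (unt HX) (B ⊗ Z) ∘ l01 (unt HB) Z.
Proof. unfold sd_unt; push; reflexivity. Qed.
Lemma sd_comulE Z : lift (w := A) (w' := Te A A) sd_comul Z
  = X ◁ sw X B (B ⊗ Z) ∘ (l12 (comul HX) (B ⊗ (B ⊗ Z)) ∘ X ◁ l12 (comul HB) Z).
Proof. unfold sd_comul; push; reflexivity. Qed.
Lemma sd_counitE Z : lift (w := A) (w' := Un) sd_counit Z
  = l10 (counit HX) Z ∘ X ◁ l10 (counit HB) Z.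
Proof. unfold sd_counit; push; reflexivity. Qed.

Ltac sd := layer; rewrite ?sd_mulE, ?sd_untE, ?sd_comulE, ?sd_counitE;
  cbn [den denm ev]; nf.

(** One bracketing moves an element of [X] past a product in [B], the other an element of [B] past a
    product in [X]; the multiplicative laws of [tau] reduce both to associativity in [X] and [B]. *)
Lemma sd_mul_assoc :
  sd_mul ∘ (sd_mul ⊠ idm (X ⊗ B))
  = sd_mul ∘ (idm (X ⊗ B) ⊠ sd_mul) ∘ asc (X ⊗ B) (X ⊗ B) (X ⊗ B).
Proof.
sd. do 2 rwr @exch21. rw @tau_mul_l. rw @tau_mul_r. rw @layer_mul_assoc.
rw @layer_mul_assoc. slide. reflexivity.
Qed.

Ltac lhs := match goal with |- _ = ?r => let R := fresh "R" in set (R := r) end.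

(** [sd_mul] is built from coalgebra morphisms: the products of [X] and [B], and [tau]. *)
Lemma sd_comul_mul :
  sd_comul ∘ sd_mul
  = (sd_mul ⊠ sd_mul) ∘ midswap (X ⊗ B) (X ⊗ B) (X ⊗ B) (X ⊗ B)
    ∘ (sd_comul ⊠ sd_comul).
Proof.
sd. rwr @exch21. rw @layer_comul_mul. rw @layer_comul_mul. repeat rw @exch12.
rw @tau_comul.
(* With the right side hidden, the left one is untangled: a pair of inverse crossings cancels and
   the others are dragged across [tau]. *)
lhs. rwr @exch_sw. rwr @exch22. rwr @exch22. rwr @exch_sw. rwr @exch_sw.
rwr @exch21. rw @sw_l21. do 2 rw @exch_sw. do 2 rw @sw_r21. rw @sw_sw.
repeat rw @exch_sw. rw @sw_r22.
do 3 rwr @exch22. do 4 rwr @exch_sw.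
rw @sw_l22.
subst R. slide. reflexivity.
Qed.

Lemma sd_mul_unitl : sd_mul ∘ (sd_unt ⊠ idm (X ⊗ B)) = lun (X ⊗ B).
Proof.
sd. rw @exch01. rw @tau_unt_l. rw @layer_mul_unitl. rw @layer_mul_unitl.
reflexivity.
Qed.

Lemma sd_mul_unitr : sd_mul ∘ (idm (X ⊗ B) ⊠ sd_unt) = run (X ⊗ B).
Proof.
sd. rw @tau_unt_r. rwr @exch01. rw @layer_mul_unitr. rw @layer_mul_unitr.
reflexivity.
Qed.

Lemma sd_comul_coassoc :
  asc (X ⊗ B) (X ⊗ B) (X ⊗ B) ∘ (sd_comul ⊠ idm (X ⊗ B)) ∘ sd_comul
  = (idm (X ⊗ B) ⊠ sd_comul) ∘ sd_comul.
Proof.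
sd. repeat rw @exch12. rw @sw_r12. rw @sw_l12. repeat rw @exch12.
do 2 rw @layer_comul_coassoc.
do 2 rwr @exch_sw. slide. reflexivity.
Qed.

Lemma sd_comul_counitl :
  lun (X ⊗ B) ∘ (sd_counit ⊠ idm (X ⊗ B)) ∘ sd_comul = idm (X ⊗ B).
Proof.
sd. repeat rw @exch12. rw @sw_r10. rw @layer_comul_counitl.
rw @layer_comul_counitl. reflexivity.
Qed.

Lemma sd_comul_counitr :
  run (X ⊗ B) ∘ (idm (X ⊗ B) ⊠ sd_counit) ∘ sd_comul = idm (X ⊗ B).
Proof.
sd. repeat rw @exch12. rwr @exch_sw. rw @layer_comul_counitr. rw @sw_l10.
rw @layer_comul_counitr. reflexivity.
Qed.

Lemma sd_comul_unt : sd_comul ∘ sd_unt = (sd_unt ⊠ sd_unt) ∘ lun_inv I1.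
Proof.
sd. rwr @exch01. rw @layer_comul_unt. rw @layer_comul_unt. rwr @exch01.
rw @sw_l01. rwr @exch01. reflexivity.
Qed.

Lemma sd_counit_mul :
  sd_counit ∘ sd_mul = lun I1 ∘ (sd_counit ⊠ sd_counit).
Proof.
sd. rwr @exch21. rw @layer_counit_mul. rw @layer_counit_mul. slide.
rw @tau_counit. reflexivity.
Qed.

Lemma sd_counit_unt : sd_counit ∘ sd_unt = idm I1.
Proof.
sd. rwr @exch01. rw @layer_counit_unt. rw @layer_counit_unt. reflexivity.
Qed.

Definition sd_bialg : Bialgebra C :=
  {| bialg_ob := X ⊗ B;
     mul := sd_mul; unt := sd_unt; comul := sd_comul; counit := sd_counit;
     mul_assoc := sd_mul_assoc;
     mul_unitl := sd_mul_unitl;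
     mul_unitr := sd_mul_unitr;
     comul_coassoc := sd_comul_coassoc;
     comul_counitl := sd_comul_counitl;
     comul_counitr := sd_comul_counitr;
     comul_mul := sd_comul_mul;
     comul_unt := sd_comul_unt;
     counit_mul := sd_counit_mul;
     counit_unt := sd_counit_unt |}.

(** * Structure maps of the semidirect product *)

Definition sd_kappa : X ~> X ⊗ B := (idm X ⊠ unt HB) ∘ run_inv X.
Definition sd_sect : B ~> X ⊗ B := (unt HX ⊠ idm B) ∘ lun_inv B.
Definition sd_alpha : X ⊗ B ~> B := lun B ∘ (counit HX ⊠ idm B).
Definition sd_lambda : X ⊗ B ~> X := run X ∘ (idm X ⊠ counit HB).

Ltac sd_maps := unfold sd_kappa, sd_sect, sd_alpha, sd_lambda; sd.

Lemma sd_kappa_mul : sd_kappa ∘ mul HX = sd_mul ∘ (sd_kappa ⊠ sd_kappa).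
Proof.
sd_maps. rw @tau_unt_l. rw @layer_mul_unitl. rwr @exch21. reflexivity.
Qed.
Lemma sd_kappa_unt : sd_kappa ∘ unt HX = sd_unt.
Proof. sd_maps. rwr @exch01. reflexivity. Qed.
Lemma sd_kappa_comul : sd_comul ∘ sd_kappa = (sd_kappa ⊠ sd_kappa) ∘ comul HX.
Proof.
sd_maps. rw @layer_comul_unt. rw @exch12. rw @sw_r01. rw @exch12. reflexivity.
Qed.
Lemma sd_kappa_counit : sd_counit ∘ sd_kappa = counit HX.
Proof. sd_maps. rw @layer_counit_unt. reflexivity. Qed.

Lemma sd_sect_mul : sd_sect ∘ mul HB = sd_mul ∘ (sd_sect ⊠ sd_sect).
Proof.
sd_maps. rwr @exch01. rw @tau_unt_r. rwr @exch01. rw @layer_mul_unitl.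
rwr @exch01. reflexivity.
Qed.
Lemma sd_sect_unt : sd_sect ∘ unt HB = sd_unt.
Proof. sd_maps. reflexivity. Qed.
Lemma sd_sect_comul : sd_comul ∘ sd_sect = (sd_sect ⊠ sd_sect) ∘ comul HB.
Proof.
sd_maps. rwr @exch01. rw @layer_comul_unt. rwr @exch01. rw @sw_l01. reflexivity.
Qed.
Lemma sd_sect_counit : sd_counit ∘ sd_sect = counit HB.
Proof. sd_maps. rwr @exch01. rw @layer_counit_unt. reflexivity. Qed.

(** This is [ε(b₁ ▷ x) b₂ = ε(x) b], the reason why the projection to [B] is multiplicative. *)
Lemma tau_counit_r Z : l10 (counit HX) (B ⊗ Z) ∘ l22 tau Z = B ◁ l10 (counit HX) Z.
Proof.
rewrite tauE; nf. rw @layer_act_counit. rw @sw_r10. rw @exch10.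
rw @layer_comul_counitl. reflexivity.
Qed.

Lemma sd_alpha_mul : sd_alpha ∘ sd_mul = mul HB ∘ (sd_alpha ⊠ sd_alpha).
Proof.
sd_maps. rw @layer_counit_mul. slide. rw @tau_counit_r. slide. reflexivity.
Qed.
Lemma sd_alpha_unt : sd_alpha ∘ sd_unt = unt HB.
Proof. sd_maps. rw @layer_counit_unt. reflexivity. Qed.
Lemma sd_alpha_comul : comul HB ∘ sd_alpha = (sd_alpha ⊠ sd_alpha) ∘ sd_comul.
Proof.
sd_maps. rw @sw_l10. rw @layer_comul_counitr. rw @exch10. reflexivity.
Qed.
Lemma sd_alpha_counit : counit HB ∘ sd_alpha = sd_counit.
Proof. sd_maps. rwr @exch10. reflexivity. Qed.

Lemma sd_lambda_unt : sd_lambda ∘ sd_unt = unt HX.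
Proof. sd_maps. rwr @exch01. rw @layer_counit_unt. reflexivity. Qed.
Lemma sd_lambda_comul : comul HX ∘ sd_lambda = (sd_lambda ⊠ sd_lambda) ∘ sd_comul.
Proof.
sd_maps. rwr @exch_sw. rw @sw_r10. repeat rw @exch12. rw @layer_comul_counitr.
reflexivity.
Qed.
Lemma sd_lambda_counit : counit HX ∘ sd_lambda = sd_counit.
Proof. sd_maps. reflexivity. Qed.

Lemma sd_lambda_kappa : sd_lambda ∘ sd_kappa = idm X.
Proof. sd_maps. rw @layer_counit_unt. reflexivity. Qed.
Lemma sd_alpha_sect : sd_alpha ∘ sd_sect = idm B.
Proof. sd_maps. rw @layer_counit_unt. reflexivity. Qed.
Lemma sd_lambda_sect : sd_lambda ∘ sd_sect = unt HX ∘ counit HB.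
Proof. sd_maps. rwr @exch01. reflexivity. Qed.
Lemma sd_alpha_kappa : sd_alpha ∘ sd_kappa = unt HB ∘ counit HX.
Proof. sd_maps. rw @exch10. reflexivity. Qed.

Lemma sd_decomp :
  sd_mul ∘ ((sd_kappa ∘ sd_lambda) ⊠ (sd_sect ∘ sd_alpha)) ∘ sd_comul
  = idm (X ⊗ B).
Proof.
sd_maps. rw @tau_unt_l. rw @layer_mul_unitl. rw @exch10. rw @layer_mul_unitr.
rw @sw_l10. rw @layer_comul_counitr.
rw @layer_comul_counitl. reflexivity.
Qed.
(** In elements [(x ⊗ 1)(1 ⊗ b) = x ⊗ b]; the condition on [λ m (κ ⊗ e)] then reduces to the
    definition of [λ]. *)
Lemma sd_kappa_sect : sd_mul ∘ (sd_kappa ⊠ sd_sect) = idm (X ⊗ B).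
Proof.
sd_maps. rw @tau_unt_l. rw @layer_mul_unitl. rw @layer_mul_unitr. reflexivity.
Qed.
(** The product in the opposite order is the distributive law, from which [λ] recovers the
    action. *)
Lemma sd_sect_kappa : sd_mul ∘ (sd_sect ⊠ sd_kappa) = tau.
Proof.
sd_maps. do 2 rwr @exch01. rw @layer_mul_unitl. rw @exch22. rw @layer_mul_unitr.
reflexivity.
Qed.

End ActionLayers.

(** * The action of a split extension *)

Section HomLayers.
Context {C : SymMonCategory} (H K : HopfAlgebra C) (f : HopfHom H K).
Notation A := (bialg_ob (hopf_bialg H)).
Notation D := (bialg_ob (hopf_bialg K)).

Lemma layer_hom_mul : forall Z, l11 f Z ∘ l21 (mul H) Z
  = l21 (mul K) Z ∘ (l11 f (D ⊗ Z) ∘ A ◁ l11 f Z).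
Proof. from (hopf_mul f). Qed.
Lemma layer_hom_unt : forall Z, l11 f Z ∘ l01 (unt H) Z = l01 (unt K) Z.
Proof. from (hopf_unt f). Qed.
Lemma layer_hom_comul : forall Z, l12 (comul K) Z ∘ l11 f Z
  = l11 f (D ⊗ Z) ∘ (A ◁ l11 f Z ∘ l12 (comul H) Z).
Proof. from (hopf_comul f). Qed.
Lemma layer_hom_counit : forall Z, l10 (counit K) Z ∘ l11 f Z = l10 (counit H) Z.
Proof. from (hopf_counit f). Qed.

End HomLayers.

Section SplitExtensions.
Context {C : SymMonCategory} (s : SplitExtension C).

Notation X := (bialg_ob (hopf_bialg (se_X s))).
Notation A := (bialg_ob (hopf_bialg (se_A s))).
Notation B := (bialg_ob (hopf_bialg (se_B s))).
Notation HX := (hopf_bialg (se_X s)).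
Notation HA := (hopf_bialg (se_A s)).
Notation HB := (hopf_bialg (se_B s)).
Notation k := (hopf_mor (kappa s)).
Notation e := (hopf_mor (sect s)).
Notation α := (hopf_mor (alpha s)).
Notation λ := (lambda s).

Lemma layer_lambda_kappa : forall Z, l11 λ Z ∘ l11 k Z = idm _.
Proof. from (lambda_kappa s). Qed.
Lemma layer_alpha_sect : forall Z, l11 α Z ∘ l11 e Z = idm _.
Proof. from (alpha_sect s). Qed.
Lemma layer_lambda_sect : forall Z,
  l11 λ Z ∘ l11 e Z = l01 (unt HX) Z ∘ l10 (counit HB) Z.
Proof. from (lambda_sect s). Qed.
Lemma layer_alpha_kappa : forall Z,
  l11 α Z ∘ l11 k Z = l01 (unt HB) Z ∘ l10 (counit HX) Z.
Proof. from (alpha_kappa s). Qed.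
Lemma layer_decomp : forall Z, l21 (mul HA) Z ∘ (l11 k (A ⊗ Z) ∘ (l11 λ (A ⊗ Z)
  ∘ (A ◁ l11 e Z ∘ (A ◁ l11 α Z ∘ l12 (comul HA) Z)))) = idm _.
Proof. from (se_decomp s). Qed.
Lemma layer_lambda_mul : forall Z,
  l11 λ Z ∘ (l21 (mul HA) Z ∘ (l11 k (A ⊗ Z) ∘ X ◁ l11 e Z))
  = X ◁ l10 (counit HB) Z.
Proof. from (lambda_mul s). Qed.
Lemma layer_lambda_comul : forall Z, l12 (comul HX) Z ∘ l11 λ Z
  = l11 λ (X ⊗ Z) ∘ (A ◁ l11 λ Z ∘ l12 (comul HA) Z).
Proof. from (lambda_comul s). Qed.
Lemma layer_lambda_counit : forall Z,
  l10 (counit HX) Z ∘ l11 λ Z = l10 (counit HA) Z.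
Proof. from (lambda_counit s). Qed.

(* Both follow by decomposing [a] as [κλ(a₁) eα(a₂)] in [κ(x) a], resp.
   [a e(b)]. *)
Lemma layer_lambda_mul_kappa Z : l11 λ Z ∘ (l21 (mul HA) Z ∘ l11 k (A ⊗ Z))
  = l21 (mul HX) Z ∘ X ◁ l11 λ Z.
Proof.
transitivity (l11 λ Z ∘ (l21 (mul HA) Z ∘ (l11 k (A ⊗ Z) ∘ X ◁ idm (A ⊗ Z)))).
  nf; reflexivity.
rewrite <- layer_decomp; nf. rw @exch11. rwr @layer_mul_assoc.
rwr @layer_hom_mul. rw @exch11. rw @exch11. rw @exch21. rw @layer_lambda_mul.
rw @exch21. rw @layer_hom_counit.
rwr @exch21. rwr @exch11. rw @layer_comul_counitr. reflexivity.
Qed.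

Lemma layer_lambda_mul_sect Z : l11 λ Z ∘ (l21 (mul HA) Z ∘ A ◁ l11 e Z)
  = l11 λ Z ∘ A ◁ l10 (counit HB) Z.
Proof.
transitivity (l11 λ Z ∘ (l21 (mul HA) Z ∘ (A ◁ l11 e Z ∘ idm (A ⊗ (B ⊗ Z))))).
  nf; reflexivity.
rewrite <- layer_decomp; nf.
rwr @exch21. rw @layer_mul_assoc. do 4 rwr @exch11. rwr1 @exch11.
rwr @layer_hom_mul. rw @exch11. rw @layer_lambda_mul. rw @exch11.
rw @layer_counit_mul. rw @exch10. rw @exch11. rw @layer_hom_counit. rwr @exch11.
rw @layer_comul_counitr. rw @exch11. reflexivity.
Qed.

Definition se_act : B ⊗ X ~> X := λ ∘ mul HA ∘ (e ⊠ k).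

Lemma se_actE Z : l21 se_act Z
  = l11 λ Z ∘ (l21 (mul HA) Z ∘ (l11 e (A ⊗ Z) ∘ B ◁ l11 k Z)).
Proof. unfold l21, se_act; push; reflexivity. Qed.

(* [e(b) κ(x) = κ(b₁ ▷ x) e(b₂)] *)
Lemma se_exchange Z :
  l21 (mul HA) Z ∘ (l11 e (A ⊗ Z) ∘ B ◁ l11 k Z)
  = l21 (mul HA) Z ∘ (l11 k (A ⊗ Z) ∘ (X ◁ l11 e Z ∘ (l21 se_act (B ⊗ Z)
     ∘ (B ◁ sw B X Z ∘ l12 (comul HB) (X ⊗ Z))))).
Proof.
(* The decomposition is applied to [a = e(b) κ(x)], whose coproduct is
   [e(b₁) κ(x₁) ⊗ e(b₂) κ(x₂)]. *)
rewrite <- (comp_idl (l21 (mul HA) Z ∘ (l11 e _ ∘ _))), <- layer_decomp; nf.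
rw @layer_comul_mul. repeat rw @exch12. rw @layer_hom_comul. repeat rw @exch12.
repeat rwr @exch11. rw @layer_hom_comul.
rw @sw_l11. rw @sw_r11. do 2 rwr @exch21. do 2 rwr @exch11. rw @layer_hom_mul.
(* Since [α(e(b₂) κ(x₂)) = b₂ ε(x₂)], the second factor becomes [e(b₂)] and the counit absorbs
   [x₂]. *)
do 6 rwr @exch11. rw @layer_alpha_sect. rwr @exch_sw. rw @layer_alpha_kappa.
rw @layer_comul_counitr.
rw @exch_sw. rw @layer_mul_unitr. rw1 @exch11. rw @exch11. rw @exch21.
rw @exch11. rwr se_actE.
reflexivity.
Qed.

Lemma se_act_unit_l : se_act ∘ (unt HB ⊠ idm X) = lun X.
Proof.
layer. rewrite se_actE; nf. rwr @exch01. rw @layer_hom_unt. rw @layer_mul_unitl.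
rw @layer_lambda_kappa. reflexivity.
Qed.
Lemma se_act_unit_r :
  se_act ∘ (idm B ⊠ unt HX) = unt HX ∘ counit HB ∘ run B.
Proof.
layer. rewrite se_actE; nf. rw @layer_hom_unt. rw @exch11. rw @layer_mul_unitr.
rw @layer_lambda_sect. reflexivity.
Qed.
Lemma se_act_cocomm :
  (idm B ⊠ se_act) ∘ asc B B X ∘ (comul HB ⊠ idm X)
  = (idm B ⊠ se_act) ∘ asc B B X ∘ (braid B B ⊠ idm X) ∘ (comul HB ⊠ idm X).
Proof.
pose proof (se_cocomm s) as E.
rewrite <- !tensm_comp, !comp_idl in E. exact E.
Qed.
Lemma se_act_counit :
  counit HX ∘ se_act = lun I1 ∘ (counit HB ⊠ counit HX).
Proof. layer.
rewrite se_actE; nf. rw @layer_lambda_counit. rw @layer_counit_mul. rwr @exch11.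
rw @layer_hom_counit. rw @layer_hom_counit. reflexivity.
Qed.
(** [λ], [m], [e] and [κ] are all morphisms of coalgebras. *)
Lemma se_act_comul :
  comul HX ∘ se_act
  = (se_act ⊠ se_act) ∘ midswap B B X X ∘ (comul HB ⊠ comul HX).
Proof.
layer. rewrite !se_actE; nf. rw @layer_lambda_comul. rw @layer_comul_mul.
repeat rw @exch12.
rw @layer_hom_comul. repeat rw @exch12. repeat rwr @exch11. rw @layer_hom_comul.
rw @sw_l11. rw @sw_r11. slide. reflexivity.
Qed.
(** By the exchange rule [e(b) e(c) κ(x) = e(b) κ(c₁ ▷ x) e(c₂)], and under [λ] the trailing [e(c₂)]
    becomes [ε(c₂)]. *)
Lemma se_act_act :
  se_act ∘ (idm B ⊠ se_act) ∘ asc B B X = se_act ∘ (mul HB ⊠ idm X).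
Proof. layer. rewrite !se_actE; nf.
(* The left side is expanded as well, [c ▷ x] becoming [(c₁ ▷ x) ε(c₂)], to match the factor that
   the right side acquires. *)
rw1 se_exchange. rw @layer_lambda_mul. symmetry. rwr @exch21. rw @layer_hom_mul.
rw @layer_mul_assoc. rwr @exch11.
rw1 se_exchange. rw @exch11. rwr @layer_mul_assoc. rw1 @exch11. rw @exch11.
rw @exch21. rw layer_lambda_mul_sect. slide. reflexivity.
Qed.
(** From [e(b) κ(x) κ(y) = κ(b₁ ▷ x) e(b₂) κ(y)], because [λ(κ(x) a) = x λ(a)]. *)
Lemma se_act_mul :
  se_act ∘ (idm B ⊠ mul HX)
  = mul HX ∘ (se_act ⊠ se_act) ∘ midswap B B X X
    ∘ (comul HB ⊠ idm (X ⊗ X)).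
Proof. layer. rewrite !se_actE; nf.
rw @layer_hom_mul. rw @exch11. rwr @layer_mul_assoc. rw se_exchange.
rw @layer_mul_assoc. rwr @exch11. rw layer_lambda_mul_kappa. rwr se_actE. slide.
reflexivity.
Qed.

Definition se_action : Action C :=
  {| act_B := se_B s; act_X := se_X s; act := se_act;
     act_unit_l := se_act_unit_l;
     act_unit_r := se_act_unit_r;
     act_cocomm := se_act_cocomm;
     act_counit := se_act_counit;
     act_comul := se_act_comul;
     act_act := se_act_act;
     act_mul := se_act_mul |}.

End SplitExtensions.

(** * The semidirect product as a split extension *)

Section Convolution.
Context {C : SymMonCategory}.

Definition conv (K A : Bialgebra C) (f g : K ~> A) : K ~> A :=
  mul A ∘ (f ⊠ g) ∘ comul K.

Lemma conv_assoc (K A : Bialgebra C) (f g h : K ~> A) :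
  conv (conv f g) h = conv f (conv g h).
Proof.
unfold conv; layer. repeat rwr @exch11. repeat rw @exch12.
rwr @layer_comul_coassoc. rw @layer_mul_assoc.
slide. reflexivity.
Qed.

Lemma conv_unitl (K A : Bialgebra C) (f : K ~> A) :
  conv (unt A ∘ counit K) f = f.
Proof.
unfold conv; layer. rw @exch10. rw @layer_comul_counitl. rw @layer_mul_unitl.
reflexivity.
Qed.

(* In a convolution monoid [q' * p'] inverts [p * q]. *)
Lemma conv_inv_mul (K A : Bialgebra C) (p p' q q' : K ~> A) :
  conv p' p = unt A ∘ counit K -> conv q' q = unt A ∘ counit K ->
  conv (conv q' p') (conv p q) = unt A ∘ counit K.
Proof.
intros pp qq.
now rewrite conv_assoc, <- (conv_assoc p' p), pp, conv_unitl.
Qed.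

(** Composing with a coalgebra morphism [p] before and an algebra morphism [i] after respects
    convolution, so [i S p] inverts [i p] because [S] inverts the identity. *)
Lemma conv_antipode_l (H : HopfAlgebra C) (A : Bialgebra C)
    (i : H ~> A) (p : A ~> H) :
  i ∘ mul H = mul A ∘ (i ⊠ i) -> i ∘ unt H = unt A ->
  comul H ∘ p = (p ⊠ p) ∘ comul A -> counit H ∘ p = counit A ->
  conv (i ∘ antipode H ∘ p) (i ∘ p) = unt A ∘ counit A.
Proof.
intros iM iU pD pE; unfold conv.
replace ((i ∘ antipode H ∘ p) ⊠ (i ∘ p))
  with ((i ⊠ i) ∘ ((antipode H ⊠ idm (H : C)) ∘ (p ⊠ p)))
  by now rewrite <- !tensm_comp, comp_idl, comp_assoc.
rewrite comp_assoc, <- iM, <- !comp_assoc, <- pD.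
rewrite (comp_assoc (_ ⊠ _) (comul H)), (comp_assoc (mul H)).
rewrite (comp_assoc (mul H)), antipode_l.
now rewrite <- comp_assoc, pE, comp_assoc, iU.
Qed.

Lemma conv_antipode_r (H : HopfAlgebra C) (A : Bialgebra C)
    (i : H ~> A) (p : A ~> H) :
  i ∘ mul H = mul A ∘ (i ⊠ i) -> i ∘ unt H = unt A ->
  comul H ∘ p = (p ⊠ p) ∘ comul A -> counit H ∘ p = counit A ->
  conv (i ∘ p) (i ∘ antipode H ∘ p) = unt A ∘ counit A.
Proof.
intros iM iU pD pE; unfold conv.
replace ((i ∘ p) ⊠ (i ∘ antipode H ∘ p))
  with ((i ⊠ i) ∘ ((idm (H : C) ⊠ antipode H) ∘ (p ⊠ p)))
  by now rewrite <- !tensm_comp, comp_idl, comp_assoc.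
rewrite comp_assoc, <- iM, <- !comp_assoc, <- pD.
rewrite (comp_assoc (_ ⊠ _) (comul H)), (comp_assoc (mul H)).
rewrite (comp_assoc (mul H)), antipode_r.
now rewrite <- comp_assoc, pE, comp_assoc, iU.
Qed.

End Convolution.

(** * The antipode on [X ⊗ B] and the split extension of an action *)

Section SemidirectProduct.
Context {C : SymMonCategory} (a : Action C).

Notation B := (bialg_ob (hopf_bialg (act_B a))).
Notation X := (bialg_ob (hopf_bialg (act_X a))).
Notation HB := (hopf_bialg (act_B a)).
Notation HX := (hopf_bialg (act_X a)).
Notation k := (sd_kappa a : X ~> sd_bialg a).
Notation e := (sd_sect a : B ~> sd_bialg a).
Notation α := (sd_alpha a : sd_bialg a ~> B).
Notation λ := (sd_lambda a : sd_bialg a ~> X).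

(* The identity is the convolution product (k λ) * (e α); inverting both
   factors and reversing the order gives the antipode. *)
Definition sd_antipode : sd_bialg a ~> sd_bialg a :=
  conv (e ∘ antipode (act_B a) ∘ α) (k ∘ antipode (act_X a) ∘ λ).

Lemma sd_antipode_l :
  mul (sd_bialg a) ∘ (sd_antipode ⊠ idm (sd_bialg a : C)) ∘ comul (sd_bialg a)
  = unt (sd_bialg a) ∘ counit (sd_bialg a).
Proof.
rewrite <- (sd_decomp a : conv (k ∘ λ) (e ∘ α) = idm (sd_bialg a : C)).
apply conv_inv_mul; apply conv_antipode_l.
- apply sd_kappa_mul.
- apply sd_kappa_unt.
- apply sd_lambda_comul.
- apply sd_lambda_counit.
- apply sd_sect_mul.
- apply sd_sect_unt.
- apply sd_alpha_comul.
- apply sd_alpha_counit.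
Qed.

Lemma sd_antipode_r :
  mul (sd_bialg a) ∘ (idm (sd_bialg a : C) ⊠ sd_antipode) ∘ comul (sd_bialg a)
  = unt (sd_bialg a) ∘ counit (sd_bialg a).
Proof.
rewrite <- (sd_decomp a : conv (k ∘ λ) (e ∘ α) = idm (sd_bialg a : C)).
(* The same inversion rule serves, now with [k λ] and [e α] as the inverses. *)
apply conv_inv_mul; apply conv_antipode_r.
- apply sd_sect_mul.
- apply sd_sect_unt.
- apply sd_alpha_comul.
- apply sd_alpha_counit.
- apply sd_kappa_mul.
- apply sd_kappa_unt.
- apply sd_lambda_comul.
- apply sd_lambda_counit.
Qed.

Definition sd_hopf : HopfAlgebra C :=
  {| hopf_bialg := sd_bialg a; antipode := sd_antipode;
     antipode_l := sd_antipode_l; antipode_r := sd_antipode_r |}.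

Definition sd_kappa_hom : HopfHom (act_X a) sd_hopf :=
  {| hopf_mor := k : act_X a ~> sd_hopf;
     hopf_mul := sd_kappa_mul a; hopf_unt := sd_kappa_unt a;
     hopf_comul := sd_kappa_comul a; hopf_counit := sd_kappa_counit a |}.
Definition sd_sect_hom : HopfHom (act_B a) sd_hopf :=
  {| hopf_mor := e : act_B a ~> sd_hopf;
     hopf_mul := sd_sect_mul a; hopf_unt := sd_sect_unt a;
     hopf_comul := sd_sect_comul a; hopf_counit := sd_sect_counit a |}.
Definition sd_alpha_hom : HopfHom sd_hopf (act_B a) :=
  {| hopf_mor := α : sd_hopf ~> act_B a;
     hopf_mul := sd_alpha_mul a; hopf_unt := sd_alpha_unt a;
     hopf_comul := sd_alpha_comul a; hopf_counit := sd_alpha_counit a |}.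

Lemma sd_lambda_tau : sd_lambda a ∘ tau a = act a.
Proof.
unfold sd_lambda; layer. rewrite tauE; nf. rwr @exch21. rw @sw_l10.
rw @layer_comul_counitr.
reflexivity.
Qed.

(** The semidirect product induces the original action on the nose; this gives its cocommutativity
    condition and the counit of the equivalence. *)
Lemma sd_lambda_sect_kappa :
  sd_lambda a ∘ sd_mul a ∘ (sd_sect a ⊠ sd_kappa a) = act a.
Proof. now rewrite <- comp_assoc, sd_sect_kappa, sd_lambda_tau. Qed.

Lemma sd_lambda_mul :
  sd_lambda a ∘ sd_mul a ∘ (sd_kappa a ⊠ sd_sect a) = run X ∘ (idm X ⊠ counit HB).
Proof. now rewrite <- comp_assoc, sd_kappa_sect, comp_idr. Qed.

Lemma sd_cocomm :
  (idm B ⊠ sd_lambda a) ∘ (idm B ⊠ sd_mul a) ∘ (idm B ⊠ (sd_sect a ⊠ sd_kappa a))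
    ∘ asc B B X ∘ (comul HB ⊠ idm X)
  = (idm B ⊠ sd_lambda a) ∘ (idm B ⊠ sd_mul a)
    ∘ (idm B ⊠ (sd_sect a ⊠ sd_kappa a))
    ∘ asc B B X ∘ (braid B B ⊠ idm X) ∘ (comul HB ⊠ idm X).
Proof.
rewrite <- !tensm_comp, !comp_idl, sd_lambda_sect_kappa. apply act_cocomm.
Qed.

Definition sd_ext : SplitExtension C :=
  {| se_X := act_X a; se_A := sd_hopf; se_B := act_B a;
     kappa := sd_kappa_hom; alpha := sd_alpha_hom; sect := sd_sect_hom;
     lambda := λ : sd_hopf ~> act_X a;
     lambda_kappa := sd_lambda_kappa a;
     alpha_sect := sd_alpha_sect a;
     lambda_sect := sd_lambda_sect a;
     alpha_kappa := sd_alpha_kappa a;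
     se_decomp := sd_decomp a;
     lambda_mul := sd_lambda_mul;
     se_cocomm := sd_cocomm;
     lambda_comul := sd_lambda_comul a;
     lambda_counit := sd_lambda_counit a;
     lambda_unt := sd_lambda_unt a |}.

End SemidirectProduct.

(** * Functoriality of the semidirect product *)

Section SemidirectHom.
Context {C : SymMonCategory} (a a' : Action C) (f : ActionHom a a').
Notation B := (bialg_ob (hopf_bialg (act_B a))).
Notation X := (bialg_ob (hopf_bialg (act_X a))).
Notation B' := (bialg_ob (hopf_bialg (act_B a'))).
Notation X' := (bialg_ob (hopf_bialg (act_X a'))).
Notation g := (hopf_mor (ah_g f)).
Notation v := (hopf_mor (ah_v f)).

Lemma layer_hom_act : forall Z, l11 v Z ∘ l21 (act a) Z
  = l21 (act a') Z ∘ (l11 g (X' ⊗ Z) ∘ B ◁ l11 v Z).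
Proof. from (ah_act f). Qed.

(** Holds as [g] is comultiplicative and [(g, v)] respects the actions; it makes [v ⊠ g]
    multiplicative. *)
Lemma tau_natural Z : l11 v (B' ⊗ Z) ∘ (X ◁ l11 g Z ∘ l22 (tau a) Z)
  = l22 (tau a') Z ∘ (l11 g (X' ⊗ Z) ∘ B ◁ l11 v Z).
Proof.
rewrite !tauE; nf. rw @layer_hom_comul. rwr @exch21. rw layer_hom_act.
rw1 @exch11.
rw @exch12. symmetry. rwr @exch11. rw @sw_l11. rw @sw_r11. reflexivity.
Qed.

Definition sd_map : X ⊗ B ~> X' ⊗ B' := v ⊠ g.

Lemma sd_map_mul : sd_map ∘ sd_mul a = sd_mul a' ∘ (sd_map ⊠ sd_map).
Proof.
unfold sd_map; layer; rewrite !sd_mulE; cbn [den denm ev]; nf.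
rwr @exch21. rw @layer_hom_mul. rw @layer_hom_mul. rwr @exch11. rwr tau_natural.
slide. reflexivity.
Qed.

Lemma sd_map_unt : sd_map ∘ sd_unt a = sd_unt a'.
Proof.
unfold sd_map, sd_unt; rewrite comp_assoc, <- tensm_comp; now rewrite !hopf_unt.
Qed.

Lemma sd_map_comul : sd_comul a' ∘ sd_map = (sd_map ⊠ sd_map) ∘ sd_comul a.
Proof.
unfold sd_map; layer; rewrite !sd_comulE; cbn [den denm ev]; nf.
rwr @exch11. rw @layer_hom_comul. rw @layer_hom_comul. do 2 rw @exch12.
rwr @exch11. rw @sw_l11. rw @sw_r11. slide. reflexivity.
Qed.

Lemma sd_map_counit : sd_counit a' ∘ sd_map = sd_counit a.
Proof.
unfold sd_map, sd_counit; rewrite <- comp_assoc, <- tensm_comp.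
now rewrite !hopf_counit.
Qed.

Lemma sd_map_kappa : sd_map ∘ sd_kappa a = sd_kappa a' ∘ v.
Proof.
unfold sd_map, sd_kappa; layer. rw @layer_hom_unt. rw @exch11. reflexivity.
Qed.

Lemma sd_map_sect : sd_map ∘ sd_sect a = sd_sect a' ∘ g.
Proof.
unfold sd_map, sd_sect; layer. rwr @exch01. rw @layer_hom_unt. reflexivity.
Qed.

Lemma sd_map_alpha : sd_alpha a' ∘ sd_map = g ∘ sd_alpha a.
Proof.
unfold sd_map, sd_alpha; layer. rw @layer_hom_counit. rw @exch10. reflexivity.
Qed.

Lemma sd_map_lambda : sd_lambda a' ∘ sd_map = v ∘ sd_lambda a.
Proof.
unfold sd_map, sd_lambda; layer. rwr @exch11. rw @layer_hom_counit. reflexivity.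
Qed.

Definition sd_map_hom : HopfHom (sd_hopf a) (sd_hopf a') :=
  {| hopf_mor := sd_map : sd_hopf a ~> sd_hopf a';
     hopf_mul := sd_map_mul; hopf_unt := sd_map_unt;
     hopf_comul := sd_map_comul; hopf_counit := sd_map_counit |}.

Definition sd_ext_hom : SplitExtHom (sd_ext a) (sd_ext a') :=
  {| sh_g := ah_g f : HopfHom (se_B (sd_ext a)) (se_B (sd_ext a'));
     sh_v := ah_v f : HopfHom (se_X (sd_ext a)) (se_X (sd_ext a'));
     sh_p := sd_map_hom : HopfHom (se_A (sd_ext a)) (se_A (sd_ext a'));
     sh_kappa := sd_map_kappa; sh_sect := sd_map_sect;
     sh_alpha := sd_map_alpha; sh_lambda := sd_map_lambda |}.

End SemidirectHom.

(** For a semidirect product the inverse comparison map [(λ ⊗ α)Δ] is the identity. *)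
Lemma sd_lambda_alpha (C : SymMonCategory) (a : Action C) :
  (sd_lambda a ⊠ sd_alpha a) ∘ sd_comul a = idm _.
Proof.
unfold sd_lambda, sd_alpha; layer; rewrite sd_comulE; cbn [den denm ev]; nf.
rw @sw_l10. rw @layer_comul_counitr. rw @layer_comul_counitl. reflexivity.
Qed.

(** * The equivalence *)

Section SplitExtensionHom.
Context {C : SymMonCategory} (s s' : SplitExtension C) (f : SplitExtHom s s').
Notation g := (hopf_mor (sh_g f)).
Notation v := (hopf_mor (sh_v f)).
Notation p := (hopf_mor (sh_p f)).

Lemma se_act_natural : v ∘ se_act s = se_act s' ∘ (g ⊠ v).
Proof.
unfold se_act.
rewrite !comp_assoc, <- sh_lambda, <- (comp_assoc _ p), hopf_mul.
rewrite <- !comp_assoc, <- !tensm_comp.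
now rewrite sh_sect, sh_kappa.
Qed.

Definition se_action_hom : ActionHom (se_action s) (se_action s') :=
  {| ah_g := sh_g f : HopfHom (act_B (se_action s)) (act_B (se_action s'));
     ah_v := sh_v f : HopfHom (act_X (se_action s)) (act_X (se_action s'));
     ah_act := se_act_natural |}.

End SplitExtensionHom.

(** * Comparison of a split extension with the semidirect product of its action *)

Section Comparison.
Context {C : SymMonCategory} (s : SplitExtension C).

Notation X := (bialg_ob (hopf_bialg (se_X s))).
Notation A := (bialg_ob (hopf_bialg (se_A s))).
Notation B := (bialg_ob (hopf_bialg (se_B s))).
Notation HX := (hopf_bialg (se_X s)).
Notation HA := (hopf_bialg (se_A s)).
Notation HB := (hopf_bialg (se_B s)).
Notation k := (hopf_mor (kappa s)).
Notation e := (hopf_mor (sect s)).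
Notation α := (hopf_mor (alpha s)).
Notation λ := (lambda s).

Definition se_of_sd : X ⊗ B ~> A := mul HA ∘ (k ⊠ e).
Definition se_to_sd : A ~> X ⊗ B := (λ ⊠ α) ∘ comul HA.

Lemma se_of_sdE Z : l21 se_of_sd Z = l21 (mul HA) Z ∘ (l11 k (A ⊗ Z) ∘ X ◁ l11 e Z).
Proof. unfold l21, se_of_sd; push; reflexivity. Qed.

(** The decomposition axiom, regrouped. *)
Lemma se_of_to : se_of_sd ∘ se_to_sd = idm A.
Proof.
unfold se_of_sd, se_to_sd.
rewrite comp_assoc, <- (comp_assoc (mul HA)), <- tensm_comp. apply se_decomp.
Qed.

Notation a := (se_action s).

Lemma se_tauE Z : l22 (tau a) Z
  = l21 (se_act s) (B ⊗ Z) ∘ (B ◁ sw B X Z ∘ l12 (comul HB) (X ⊗ Z)).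
Proof. apply tauE. Qed.

Lemma se_of_sd_mul :
  se_of_sd ∘ sd_mul a = mul HA ∘ (se_of_sd ⊠ se_of_sd).
Proof.
layer; rewrite sd_mulE, !se_of_sdE; cbn [den denm ev].
change (act_X a) with (se_X s); change (act_B a) with (se_B s); nf.
rewrite se_tauE; nf.
rwr @exch21. rw @layer_hom_mul. rw @layer_hom_mul. rw @layer_mul_assoc.
rw @layer_mul_assoc.
rw1 @exch11. rwr @exch11. rwr1 @layer_mul_assoc. symmetry. rw1 @exch11.
rwr @exch11. rwr1 @layer_mul_assoc.
(* In [κ(x) e(b) κ(x') e(b')] the inner pair [e(b) κ(x')] is now isolated. *)
rw @se_exchange. slide. reflexivity.
Qed.

Lemma se_of_sd_unt : se_of_sd ∘ sd_unt a = unt HA.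
Proof.
unfold sd_unt, se_of_sd; rewrite comp_assoc, <- (comp_assoc (mul HA)), <- tensm_comp.
change (act_X a) with (se_X s); change (act_B a) with (se_B s).
rewrite !hopf_unt; layer. rw @layer_mul_unitl. reflexivity.
Qed.

Lemma se_of_sd_comul :
  comul HA ∘ se_of_sd = (se_of_sd ⊠ se_of_sd) ∘ sd_comul a.
Proof.
unfold sd_comul; change (act_X a) with (se_X s); change (act_B a) with (se_B s).
layer; rewrite !se_of_sdE; nf.
rw @layer_comul_mul. repeat rw @exch12. rw @layer_hom_comul. repeat rw @exch12.
repeat rwr @exch11. rw @layer_hom_comul.
rw @sw_l11. rw @sw_r11. slide. reflexivity.
Qed.

Lemma se_of_sd_counit : counit HA ∘ se_of_sd = sd_counit a.
Proof.
unfold sd_counit; layer. rewrite !se_of_sdE; nf. rw @layer_counit_mul.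
rwr @exch11. rw @layer_hom_counit. rw @layer_hom_counit. reflexivity.
Qed.

Lemma se_of_sd_kappa : se_of_sd ∘ sd_kappa a = k.
Proof.
unfold sd_kappa; layer. rewrite !se_of_sdE; nf. rw @layer_hom_unt. rw @exch11.
rw @layer_mul_unitr. reflexivity.
Qed.
Lemma se_of_sd_sect : se_of_sd ∘ sd_sect a = e.
Proof.
unfold sd_sect; layer. rewrite !se_of_sdE; nf. rwr @exch01. rw @layer_hom_unt.
rw @layer_mul_unitl. reflexivity.
Qed.
Lemma se_of_sd_alpha : α ∘ se_of_sd = sd_alpha a.
Proof.
unfold sd_alpha; layer. rewrite !se_of_sdE; nf. rw @layer_hom_mul. rwr @exch11.
rw @layer_alpha_sect. rw @layer_alpha_kappa. rw @layer_mul_unitl. reflexivity.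
Qed.
Lemma se_of_sd_lambda : λ ∘ se_of_sd = sd_lambda a.
Proof. unfold se_of_sd; rewrite comp_assoc; apply lambda_mul. Qed.

(** As [se_of_sd] is comultiplicative and carries [λ], [α] to those of the semidirect product, the
    composite is [(λ ⊗ α)Δ] computed there. *)
Lemma se_to_of : se_to_sd ∘ se_of_sd = idm (X ⊗ B).
Proof.
unfold se_to_sd; rewrite <- comp_assoc, se_of_sd_comul, comp_assoc, <- tensm_comp.
rewrite se_of_sd_alpha, se_of_sd_lambda. exact (sd_lambda_alpha a).
Qed.

Definition se_of_sd_hom : HopfHom (sd_hopf a) (se_A s) :=
  {| hopf_mor := se_of_sd : sd_hopf a ~> se_A s;
     hopf_mul := se_of_sd_mul; hopf_unt := se_of_sd_unt;
     hopf_comul := se_of_sd_comul; hopf_counit := se_of_sd_counit |}.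

End Comparison.

(** An inverse of a bialgebra morphism is one itself, so [se_to_sd] inherits all its compatibilities
    from [se_of_sd]. The underlying map stays [h] by computation. *)
Definition hopf_hom_inv (C : SymMonCategory) (H K : HopfAlgebra C)
    (f : HopfHom H K) (h : K ~> H) :
  f ∘ h = idm (K : C) -> h ∘ f = idm (H : C) ->
  HopfHom K H.
Proof.
intros fh hf.
assert (fhfh : (hopf_mor f ⊠ hopf_mor f) ∘ (h ⊠ h) = idm ((K : C) ⊗ K))
  by now rewrite <- tensm_comp, fh, tensm_id.
assert (hfhf : (h ⊠ h) ∘ (hopf_mor f ⊠ hopf_mor f) = idm ((H : C) ⊗ H))
  by now rewrite <- tensm_comp, hf, tensm_id.
refine {| hopf_mor := h |}.
- now rewrite <- (comp_idr (mul K)), <- fhfh, (comp_assoc (mul K)), <- hopf_mul,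
    !comp_assoc, hf, comp_idl.
- now rewrite <- (hopf_unt f), comp_assoc, hf, comp_idl.
- now rewrite <- (comp_idl (comul H)), <- hfhf, <- (comp_assoc _ _ (comul H)),
    <- hopf_comul, <- !comp_assoc, fh, comp_idr.
- now rewrite <- (hopf_counit f), <- comp_assoc, fh, comp_idr.
Defined.

(** * The two functors and the natural isomorphisms *)

Section Equivalence.
Context {C : SymMonCategory}.

Definition action_functor : Functor (SplitExt C) (Act C).
Proof.
refine {| fob := @se_action C : SplitExt C -> Act C;
          fmap := fun s s' (f : s ~> s') => se_action_hom f |}.
- intros s; now apply action_hom_ext; apply hopf_hom_ext.
- intros s s' s'' f' f; now apply action_hom_ext; apply hopf_hom_ext.
Defined.

Definition semidirect_functor : Functor (Act C) (SplitExt C).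
Proof.
refine {| fob := @sd_ext C : Act C -> SplitExt C;
          fmap := fun a a' (f : a ~> a') => sd_ext_hom f |}.
- intros a; apply split_ext_hom_ext; apply hopf_hom_ext; trivial.
  apply tensm_id.
- intros a a' a'' f' f; apply split_ext_hom_ext; apply hopf_hom_ext; trivial.
  apply tensm_comp.
Defined.

Definition se_to_sd_hom (s : SplitExtension C) :
    HopfHom (se_A s) (sd_hopf (se_action s)) :=
  hopf_hom_inv (f := se_of_sd_hom s) (h := se_to_sd s)
    (se_of_to s) (se_to_of s).

Definition unit_bwd (s : SplitExtension C) :
  SplitExtHom (sd_ext (se_action s)) s.
Proof.
refine (@Build_SplitExtHom C (sd_ext (se_action s)) s
  (hopf_id (se_B s)) (hopf_id (se_X s)) (se_of_sd_hom s) _ _ _ _); simpl;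
  rewrite ?comp_idl, ?comp_idr.
- apply se_of_sd_kappa.
- apply se_of_sd_sect.
- apply se_of_sd_alpha.
- apply se_of_sd_lambda.
Defined.

Definition unit_fwd (s : SplitExtension C) :
  SplitExtHom s (sd_ext (se_action s)).
Proof.
refine (@Build_SplitExtHom C s (sd_ext (se_action s))
  (hopf_id (se_B s)) (hopf_id (se_X s)) (se_to_sd_hom s) _ _ _ _); simpl;
  rewrite ?comp_idl, ?comp_idr.
(* Each condition is the one for [se_of_sd] with the inverse cancelled. *)
- rewrite <- (se_of_sd_kappa s), comp_assoc, se_to_of. apply comp_idl.
- rewrite <- (se_of_sd_sect s), comp_assoc, se_to_of. apply comp_idl.
- rewrite <- (se_of_sd_alpha s), <- comp_assoc, se_of_to. apply comp_idr.
- rewrite <- (se_of_sd_lambda s), <- comp_assoc, se_of_to. apply comp_idr.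
Defined.

Lemma unit_natural (s s' : SplitExtension C) (f : SplitExtHom s s') :
  (unit_fwd s' : @Hom (SplitExt C) _ _) ∘ f
  = fmap semidirect_functor (fmap action_functor f)
    ∘ (unit_fwd s : @Hom (SplitExt C) s (semidirect_functor (action_functor s))).
Proof.
apply split_ext_hom_ext; apply hopf_hom_ext; simpl;
  try (rewrite comp_idl, comp_idr; reflexivity).
(* Only the component on [A] has content: [(λ' ⊗ α')Δ p = (λ' p ⊗ α' p)Δ = (v λ ⊗ g α)Δ]. *)
unfold se_to_sd, sd_map; simpl.
now rewrite <- comp_assoc, hopf_comul, !comp_assoc, <- !tensm_comp,
  sh_lambda, sh_alpha.
Qed.

Definition unit_iso : NatIso (functor_id (SplitExt C))
  (functor_comp semidirect_functor action_functor).
Proof.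
refine (@Build_NatIso _ _ (functor_id (SplitExt C))
  (functor_comp semidirect_functor action_functor) unit_fwd unit_bwd
  unit_natural _ _);
  intros s; apply split_ext_hom_ext; apply hopf_hom_ext; simpl; try apply comp_idl.
- apply se_of_to.
- apply se_to_of.
Defined.

(** The identities of [B] and [X] suffice, as the original action is recovered exactly. *)
Definition counit_fwd (a : Action C) : ActionHom (se_action (sd_ext a)) a.
Proof.
refine (@Build_ActionHom C (se_action (sd_ext a)) a
  (hopf_id (act_B a)) (hopf_id (act_X a)) _); simpl.
rewrite tensm_id, comp_idl, comp_idr. apply sd_lambda_sect_kappa.
Defined.

Definition counit_bwd (a : Action C) : ActionHom a (se_action (sd_ext a)).
Proof.
refine (@Build_ActionHom C a (se_action (sd_ext a))
  (hopf_id (act_B a)) (hopf_id (act_X a)) _); simpl.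
rewrite tensm_id, comp_idl, comp_idr. symmetry; apply sd_lambda_sect_kappa.
Defined.

Definition counit_iso : NatIso (functor_comp action_functor semidirect_functor)
  (functor_id (Act C)).
Proof.
refine (@Build_NatIso _ _ (functor_comp action_functor semidirect_functor)
  (functor_id (Act C)) counit_fwd counit_bwd _ _ _).
- intros a a' f; apply action_hom_ext; apply hopf_hom_ext; simpl;
    rewrite comp_idl, comp_idr; reflexivity.
- intros a; apply action_hom_ext; apply hopf_hom_ext; apply comp_idl.
- intros a; apply action_hom_ext; apply hopf_hom_ext; apply comp_idl.
Defined.

End Equivalence.

Theorem corollary4p11 (C : SymMonCategory) :
  inhabited (Equivalence (SplitExt C) (Act C)).
Proof. exact (inhabits (Build_Equivalence unit_iso counit_iso)). Qed.
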